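(* Let $(n_{ij})_{1\le i\le R,\,1\le j\le C}$ be cell counts of an $R\times C$ contingency table following a multinomial distribution with total $n=\sum_{i,j}n_{ij}$ and cell probabilities $p_{ij}$, with marginals $p_{i\cdot}=\sum_l p_{il}$, $p_{\cdot j}=\sum_k p_{kj}$. Let $f$ be a differentiable function with derivative $f'$ satisfying: $f$ convex, $0\cdot f(0/0)=0$, $\lim_{x\to+0}f(x)=0$, $f(1)=0$. Define \[ \Phi_{Gf}=\frac{-\sum_{j=1}^C f(p_{\cdot j})-\prod_{i=1}^R \left[-\sum_{j=1}^C f\!\left(p_{ij}/p_{i\cdot}\right)\right]^{p_{i\cdot}}}{-\sum_{j=1}^C f(p_{\cdot j})}, \] and let $\widehat{\Phi}_{Gf}$ be the plug-in estimator obtained by replacing each $p_{ij}$ by $\widehat p_{ij}=n_{ij}/n$. Then, as $n\to\infty$, $\sqrt{n}\,(\widehat{\Phi}_{Gf}-\Phi_{Gf})$ converges in distribution to a normal distribution with mean $0$ and variance \[ \sigma^2[\Phi_{Gf}]=\left(\delta^{(f)}\right)^2\left[\sum_{i=1}^R\sum_{j=1}^C p_{ij}\left(\Delta_{ij}^{(f)}\right)^2-\left(\sum_{i=1}^R\sum_{j=1}^C p_{ij}\Delta_{ij}^{(f)}\right)^2\right], \] where \[ \delta^{(f)}=\frac{\prod_{s=1}^R\left[-\sum_{t=1}^C f\!\left(p_{st}/p_{s\cdot}\right)\right]^{p_{s\cdot}}}{\left(\sum_{t=1}^C f(p_{\cdot t})\right)^2},\qquad \Delta_{ij}^{(f)}=f'(p_{\cdot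 j})-\varepsilon_{ij}^{(f)}\sum_{t=1}^C f(p_{\cdot t}), \] \[ \varepsilon_{ij}^{(f)}=\log\left[-\sum_{t=1}^C f\!\left(\frac{p_{it}}{p_{i\cdot}}\right)\right]+\frac{\sum_{t=1}^C\left\{-\frac{p_{it}}{p_{i\cdot}}f'\!\left(\frac{p_{it}}{p_{i\cdot}}\right)\right\}+f'\!\left(\frac{p_{ij}}{p_{i\cdot}}\right)}{\sum_{t=1}^C f\!\left(\frac{p_{it}}{p_{i\cdot}}\right)}. \]
   Context: The probabilities are assumed to be such that $\Phi_{Gf}$, viewed as a function of the vector $(p_{ij})$, is well-defined and differentiable at the true $(p_{ij})$ and all quantities in the formulas are finite (in particular $p_{\cdot j}>0$, $p_{i\cdot}>0$, $-\sum_t f(p_{it}/p_{i\cdot})>0$ for all $i$, and $\sum_t f(p_{\cdot t})\neq 0$). *)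

(* Defs.v *)
From HB Require Import structures.
From mathcomp Require Import all_boot all_order all_algebra.
From mathcomp Require Import all_classical all_reals all_analysis.
Set Implicit Arguments. Unset Strict Implicit. Unset Printing Implicit Defensive.
Import Order.TTheory GRing.Theory Num.Theory.
Import numFieldNormedType.Exports.
Local Open Scope classical_set_scope.
Local Open Scope ring_scope.

Section Defs.
Variables (R : realType) (nR nC : nat).

Definition rowm (p : 'I_nR -> 'I_nC -> R) (i : 'I_nR) := \sum_(l < nC) p i l.
Definition colm (p : 'I_nR -> 'I_nC -> R) (j : 'I_nC) := \sum_(k < nR) p k j.

Definition PhiGf (f : R -> R) (p : 'I_nR -> 'I_nC -> R) : R :=
  (- (\sum_(j < nC) f (colm p j))
   - \prod_(i < nR) (powR (- \sum_(j < nC) f (p i j / rowm p i)) (rowm p i)))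
  / (- (\sum_(j < nC) f (colm p j))).

Definition deltaf (f : R -> R) (p : 'I_nR -> 'I_nC -> R) : R :=
  (\prod_(s < nR) powR (- \sum_(t < nC) f (p s t / rowm p s)) (rowm p s))
  / (\sum_(t < nC) f (colm p t)) ^+ 2.

Definition epsf (f : R -> R) (p : 'I_nR -> 'I_nC -> R) i j : R :=
  ln (- \sum_(t < nC) f (p i t / rowm p i))
  + (\sum_(t < nC) (- (p i t / rowm p i) * derive1 f (p i t / rowm p i))
     + derive1 f (p i j / rowm p i))
    / (\sum_(t < nC) f (p i t / rowm p i)).

Definition Deltaf (f : R -> R) (p : 'I_nR -> 'I_nC -> R) i j : R :=
  derive1 f (colm p j) - epsf f p i j * \sum_(t < nC) f (colm p t).

Definition sigma2Gf (f : R -> R) (p : 'I_nR -> 'I_nC -> R) : R :=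
  deltaf f p ^+ 2 *
  (\sum_(i < nR) \sum_(j < nC) p i j * Deltaf f p i j ^+ 2
   - (\sum_(i < nR) \sum_(j < nC) p i j * Deltaf f p i j) ^+ 2).

(* Multinomial sampling of size n: n i.i.d. draws of a cell (i,j) with
   probability p i j; counts s i j = number of draws falling in cell (i,j).
   multinom_expect p n h = E[h(counts)] where counts ~ Multinomial(n, p). *)
Definition counts n (s : {ffun 'I_n -> 'I_nR * 'I_nC}) (i : 'I_nR) (j : 'I_nC)
  : nat := #|[set k | s k == (i, j)]|.

Definition multinom_expect (p : 'I_nR -> 'I_nC -> R) n
  (h : ('I_nR -> 'I_nC -> nat) -> R) : R :=
  \sum_(s : {ffun 'I_n -> 'I_nR * 'I_nC})
     (\prod_(k < n) p (s k).1 (s k).2) * h (counts s).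

Definition phat n (N : 'I_nR -> 'I_nC -> nat) : 'I_nR -> 'I_nC -> R :=
  fun i j => (N i j)%:R / n%:R.

End Defs.

(* Expectation of g under N(0, v): the Gaussian law when v > 0,
   the degenerate normal law (Dirac mass at 0) when v = 0. *)
Definition normal_expect {R : realType} (v : R) (g : R -> R) : R :=
  if 0 < v then fine (\int[normal_prob 0 (Num.sqrt v)]_x (g x)%:E)%E
  else g 0.

(* Convergence in distribution of a sequence of real random variables,
   given through their expectation functionals E n g = E[g(Z_n)],
   to N(0, v): E[g(Z_n)] -> E[g(Z)] for all bounded continuous g. *)
Definition cvg_in_law_normal {R : realType} (E : nat -> (R -> R) -> R) (v : R)
  : Prop :=
  forall g : R -> R, continuous g -> (exists M : R, forall x, `|g x| <= M) ->
    E n g @[n --> \oo] --> normal_expect v g.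
Arguments phat {R nR nC} n N.

(* Main.v *)
Require Import Defs.
From HB Require Import structures.
From mathcomp Require Import all_boot all_order all_algebra.
From mathcomp Require Import all_classical all_reals all_analysis.
From mathcomp Require Import measurable_realfun.
From mathcomp Require Import ring lra.
Set Implicit Arguments.
Unset Strict Implicit.
Unset Printing Implicit Defensive.
Import Order.TTheory GRing.Theory Num.Theory.
Import numFieldNormedType.Exports.
Local Open Scope classical_set_scope.
Local Open Scope ring_scope.

(** Fréchet differentiability of [PhiGf] at [p] writes
    [sqrt n * (PhiGf phat - PhiGf p)] as the normalized sum of the i.i.d. centered
    variables [a (cell of draw k) - E a], where [a = - delta * Delta] is the
    gradient, plus a remainder that is small compared with
    [sqrt n * |phat - p|], whose second moment is bounded.

    The central limit theorem for finitely supported variables is obtained by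
    Lindeberg replacement in operator form.  One step of the walk and one
    Gaussian step of the same variance agree up to [O(n^(-3/2))] on functions with
    a uniform second-order Taylor expansion; this class and sup-norm bounds are
    preserved by both operators, and Gaussian steps compose, so [n] steps differ by
    [O(n^(-1/2))].  A bounded continuous function is approximated, up to
    [e + k x^2], by such smooth functions, and second moments are preserved. *)

(** * Gaussian smoothing *)

Section GaussianSmoothing.
Context {R : realType}.
Implicit Types (x y s m r : R) (u v : R -> R).
Notation mu := (@lebesgue_measure R).

(** A bounded continuous [g] need not be uniformly continuous, so it cannot be approximated
    uniformly at a fixed scale. Test functions are therefore compared with an error
    [e + k * x ^+ 2]. The normalized sum has exactly the limit variance [v] for every positive [n],
    so the quadratic part costs [k * v] and no tightness argument is needed. The same device stands
    in for Slutsky's lemma in the delta method. The one Gaussian integral taken as known is the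
    total mass 1 of a density. Shifting or rescaling the density turns it into exact exponential
    moments, and these give the mean, the variance and a crude bound on the third absolute moment.
    [PhiGf] is differentiated on the whole space of matrices, not on the simplex; centering the
    gradient under [p] produces the subtracted square in [sigma2Gf]. Zero variance is a separate
    case, the limit then having no density. *)

Definition gaussf x s u y : R := u y * normal_pdf x s y.

Definition gauss_integrable x s u := mu.-integrable setT (EFin \o gaussf x s u).

(** Smoothing of [u] at [x]. With a density against Lebesgue measure, a change of [x] or [s] is a
    pointwise identity and Fubini applies; [normal_expect_gauss] makes the link with
    [normal_prob]. *)
Definition gauss x s u : R := \int[mu]_y gaussf x s u y.

(** Exponential change of measure: the shifted density has mass 1, so its ratio to the original one
    is a function whose Gaussian mean is known exactly. *)
Lemma normal_pdf_tilt x s m y : s != 0 ->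
  normal_pdf (x + m) s y
  = expR (m * (y - x) / s ^+ 2 - m ^+ 2 / (s ^+ 2 *+ 2)) * normal_pdf x s y.
Proof.
move=> s0; rewrite !normal_pdfE// mulrCA; congr (_ * _).
rewrite /normal_fun -expRD; congr expR.
by field.
Qed.

(** Same principle with a quadratic exponent. For [r] above 1 the exponent is nonnegative, so the
    ratio also dominates powers of [y - x]. *)
Lemma normal_pdf_scale x s r y : s != 0 -> 0 < r ->
  normal_pdf x (s * r) y
  = r^-1 * expR ((1 - r ^- 2) * (y - x) ^+ 2 / (s ^+ 2 *+ 2)) * normal_pdf x s y.
Proof.
move=> s0 r0; have sr0 : s * r != 0 by rewrite mulf_neq0// gt_eqF.
rewrite !normal_pdfE//.
have -> : normal_peak (s * r) = r^-1 * normal_peak s.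
  rewrite /normal_peak (_ : (s * r) ^+ 2 * pi *+ 2 = r ^+ 2 * (s ^+ 2 * pi *+ 2)).
    by rewrite sqrtrM ?sqr_ge0// sqrtr_sqr gtr0_norm// invfM.
  by ring.
rewrite -!mulrA; congr (_ * _); rewrite [RHS]mulrCA; congr (_ * _).
rewrite /normal_fun -expRD; congr expR.
by field; rewrite s0 gt_eqF.
Qed.

Lemma measurable_gaussf x s u : measurable_fun setT u ->
  measurable_fun setT (gaussf x s u).
Proof. by move=> mu_; apply: measurable_funM => //; exact: measurable_normal_pdf. Qed.

Lemma gauss_integrable_le x s u v : measurable_fun setT u ->
  (forall y, `|u y| <= v y) -> gauss_integrable x s v -> gauss_integrable x s u.
Proof.
move=> mu_ uv; apply: le_integrable => //=.
  by apply/measurable_EFinP; exact: measurable_gaussf.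
move=> y _; rewrite lee_fin /gaussf !normrM ler_wpM2r//.
by rewrite (le_trans (uv y))// ler_norm.
Qed.

Lemma gauss_integrableD x s u v : gauss_integrable x s u ->
  gauss_integrable x s v -> gauss_integrable x s (u \+ v).
Proof.
move=> iu iv; have := integrableD measurableT iu iv.
by apply: eq_integrable => // y _; rewrite /gaussf /= mulrDl EFinD.
Qed.

Lemma gauss_integrableZ x s u r : gauss_integrable x s u ->
  gauss_integrable x s (fun y => r * u y).
Proof.
move=> iu; have := integrableZl measurableT r iu.
by apply: eq_integrable => // y _; rewrite /gaussf /= -mulrA EFinM.
Qed.

Lemma gaussD x s u v : gauss_integrable x s u -> gauss_integrable x s v ->
  gauss x s (u \+ v) = gauss x s u + gauss x s v.
Proof.
move=> iu iv; rewrite /gauss -RintegralD//.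
by apply: eq_Rintegral => y _; rewrite /gaussf /= mulrDl.
Qed.

Lemma gaussZ x s u r : gauss_integrable x s u ->
  gauss x s (fun y => r * u y) = r * gauss x s u.
Proof.
move=> iu; rewrite /gauss -RintegralZl//.
by apply: eq_Rintegral => y _; rewrite /gaussf /= mulrA.
Qed.

Lemma ler_gauss x s u v : gauss_integrable x s u -> gauss_integrable x s v ->
  (forall y, u y <= v y) -> gauss x s u <= gauss x s v.
Proof.
move=> iu iv uv; apply: le_Rintegral => // y _.
by rewrite ler_wpM2r// normal_pdf_ge0.
Qed.

Lemma gauss_integrable_cst x s r : gauss_integrable x s (cst r).
Proof.
have := integrableZl measurableT r (integrable_normal_pdf x s).
by apply: eq_integrable.
Qed.

Lemma gauss_cst x s r : gauss x s (cst r) = r.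
Proof.
rewrite -[RHS]mulr1 /gauss RintegralZl//; last exact: integrable_normal_pdf.
by rewrite /Rintegral integral_normal_pdf.
Qed.

Lemma gauss_integrable_tilt x s m : s != 0 -> gauss_integrable x s
  (fun y => expR (m * (y - x) / s ^+ 2 - m ^+ 2 / (s ^+ 2 *+ 2))).
Proof.
move=> s0; have := integrable_normal_pdf (x + m) s.
by apply: eq_integrable => // y _; rewrite normal_pdf_tilt.
Qed.

Lemma gauss_tilt x s m : s != 0 ->
  gauss x s (fun y => expR (m * (y - x) / s ^+ 2 - m ^+ 2 / (s ^+ 2 *+ 2))) = 1.
Proof.
move=> s0; rewrite -[RHS](gauss_cst (x + m) s); apply: eq_Rintegral => y _.
by rewrite /gaussf mul1r normal_pdf_tilt.
Qed.

Lemma gauss_integrable_scale x s r : s != 0 -> 0 < r -> gauss_integrable x s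
  (fun y => r^-1 * expR ((1 - r ^- 2) * (y - x) ^+ 2 / (s ^+ 2 *+ 2))).
Proof.
move=> s0 r0; have := integrable_normal_pdf x (s * r).
by apply: eq_integrable => // y _; rewrite normal_pdf_scale.
Qed.

Lemma gauss_scale x s r : s != 0 -> 0 < r -> gauss x s
  (fun y => r^-1 * expR ((1 - r ^- 2) * (y - x) ^+ 2 / (s ^+ 2 *+ 2))) = 1.
Proof.
move=> s0 r0; rewrite -[RHS](gauss_cst x (s * r)); apply: eq_Rintegral => y _.
by rewrite /gaussf mul1r normal_pdf_scale.
Qed.

(** The constant is 8 * (1 + 32): [(1 + t) ^+ 4] is at most [8 * (1 + t ^+ 4)], and the quadratic
    term of the exponential series bounds [t ^+ 4] by [32 * expR (t ^+ 2 / 4)]. *)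
Lemma expR_dominates_pow (t : R) (k : nat) : 0 <= t -> (k <= 4)%N ->
  t ^+ k <= 264 * expR (t ^+ 2 / 4).
Proof.
move=> t0 k4; apply: (@le_trans _ _ ((1 + t) ^+ 4)).
  apply: (@le_trans _ _ ((1 + t) ^+ k)); first by rewrite lerXn2r ?nnegrE; lra.
  by apply: ler_weXn2l => //; lra.
have : 1 + (t ^+ 2 / 4) ^+ 2 / 2 <= expR (t ^+ 2 / 4).
  by apply: (@expR_ge1Dxn _ _ 1); rewrite divr_ge0// sqr_ge0.
have t4 : 0 <= t ^+ 4 by rewrite exprn_ge0.
suff: (1 + t) ^+ 4 <= 8 * (1 + t ^+ 4) by lra.
(* This product is the factorization of [8 * (1 + t ^+ 4) - (1 + t) ^+ 4], which has a double root
   at 1. *)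
have : 0 <= (t - 1) ^+ 2 * (7 * t ^+ 2 + 10 * t + 7).
  by rewrite mulr_ge0 ?sqr_ge0//; nra.
lra.
Qed.

(* The dominating function is a multiple of the ratio of the densities of
   N(x, 2 s^2) and N(x, s^2). *)
Lemma moment_dominated x s (k : nat) y : 0 < s -> (k <= 4)%N ->
  `|y - x| ^+ k <= s ^+ k * 264 * Num.sqrt 2
    * ((Num.sqrt 2)^-1 * expR ((1 - (Num.sqrt 2) ^- 2) * (y - x) ^+ 2 / (s ^+ 2 *+ 2))).
Proof.
move=> s0 k4; have s0' : s != 0 by rewrite gt_eqF.
have q2 : 0 < Num.sqrt 2 :> R by rewrite sqrtr_gt0.
rewrite mulrA mulfK ?gt_eqF// sqr_sqrtr//.
pose t := `|y - x| / s.
have t0 : 0 <= t by rewrite divr_ge0// ltW.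
have -> : (1 - 2^-1) * (y - x) ^+ 2 / (s ^+ 2 *+ 2) = t ^+ 2 / 4.
  by rewrite -(real_normK (num_real (y - x))) /t; field.
have -> : `|y - x| = s * t by rewrite /t mulrC divfK.
rewrite exprMn -mulrA ler_wpM2l ?exprn_ge0 ?(ltW s0)//.
exact: expR_dominates_pow.
Qed.

Lemma gauss_integrable_norm_moment x s (k : nat) : 0 < s -> (k <= 4)%N ->
  gauss_integrable x s (fun y => `|y - x| ^+ k).
Proof.
move=> s0 k4; have s0' : s != 0 by rewrite gt_eqF.
have q2 : 0 < Num.sqrt 2 :> R by rewrite sqrtr_gt0.
have := @gauss_integrableZ x s _ (s ^+ k * 264 * Num.sqrt 2)
  (@gauss_integrable_scale x s (Num.sqrt 2) s0' q2).
apply: gauss_integrable_le.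
  by apply: measurable_funX; apply: measurableT_comp => //; exact: measurable_funB.
by move=> y; rewrite normrX normr_id moment_dominated.
Qed.

Lemma gauss_norm_moment_le x s (k : nat) : 0 < s -> (k <= 4)%N ->
  gauss x s (fun y => `|y - x| ^+ k) <= s ^+ k * 264 * Num.sqrt 2.
Proof.
move=> s0 k4; have s0' : s != 0 by rewrite gt_eqF.
have q2 : 0 < Num.sqrt 2 :> R by rewrite sqrtr_gt0.
rewrite -[leRHS]mulr1 -[X in _ * X](gauss_scale x s0' q2) -gaussZ; last first.
  exact: gauss_integrable_scale.
apply: ler_gauss; first exact: gauss_integrable_norm_moment.
  by apply: gauss_integrableZ; exact: gauss_integrable_scale.
by move=> y; exact: moment_dominated.
Qed.

Lemma gauss_integrable_moment x s (k : nat) : 0 < s -> (k <= 4)%N ->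
  gauss_integrable x s (fun y => (y - x) ^+ k).
Proof.
move=> s0 k4; have := gauss_integrable_norm_moment x s0 k4.
apply: gauss_integrable_le; last by move=> y; rewrite normrX.
by apply: measurable_funX; exact: measurable_funB.
Qed.

(* Tilting gives E[exp(m (Y - x)/s^2 - m^2/(2 s^2))] = 1, and exp t >= 1 + t
   turns this into m E[Y - x] <= m^2/2 for every m. *)
Lemma gauss_mean x s : 0 < s -> gauss x s (fun y => y - x) = 0.
Proof.
move=> s0; have s0' : s != 0 by rewrite gt_eqF.
have i1 := @gauss_integrable_moment x s 1 s0 isT.
set e := gauss _ _ _.
have key m : m * e <= m ^+ 2 / 2.
  have ic := gauss_integrable_cst x s (1 - m ^+ 2 / (s ^+ 2 *+ 2)).
  have iz := gauss_integrableZ (m / s ^+ 2) i1.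
  have : gauss x s (cst (1 - m ^+ 2 / (s ^+ 2 *+ 2))
           \+ (fun y => m / s ^+ 2 * (y - x) ^+ 1)) <= 1.
    rewrite -[leRHS](gauss_tilt x m s0'); apply: ler_gauss.
    - exact: gauss_integrableD.
    - exact: gauss_integrable_tilt.
    - by move=> y /=; apply: le_trans (expR_ge1Dx _); rewrite expr1; lra.
  rewrite gaussD// gaussZ// gauss_cst (_ : gauss x s _ = e)//.
  have -> : m / s ^+ 2 * e = (m * e) / s ^+ 2 by ring.
  have -> : 1 - m ^+ 2 / (s ^+ 2 *+ 2) = 1 - (m ^+ 2 / 2) / s ^+ 2 by field.
  have h : 0 < (s ^+ 2)^-1 by rewrite invr_gt0 exprn_gt0.
  move=> H; rewrite -(ler_pM2r h); move: H.
  by set P := m * e / _; set Q := m ^+ 2 / 2 / _; lra.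
(* The choice [m = e] gives [e ^+ 2 <= e ^+ 2 / 2]. *)
have := key e; have := sqr_ge0 e; rewrite -expr2 => h1 h2.
by apply/eqP; rewrite -sqrf_eq0 eq_le h1 andbT; lra.
Qed.

(* Rescaling gives E[exp((1 - r^-2)(Y - x)^2/(2 s^2))] = r, and exp t >= 1 + t
   turns this into upper and lower bounds as r tends to 1 from either side. *)
Lemma gauss_variance x s : 0 < s -> gauss x s (fun y => (y - x) ^+ 2) = s ^+ 2.
Proof.
move=> s0; have s0' : s != 0 by rewrite gt_eqF.
have i2 := @gauss_integrable_moment x s 2 s0 isT.
set e := gauss _ _ _.
have key r : 0 < r -> 1 + (1 - r ^- 2) / 2 * (e / s ^+ 2) <= r.
  move=> r0; have r0' : r != 0 by rewrite gt_eqF.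
  have ic := gauss_integrable_cst x s r^-1.
  have iz := gauss_integrableZ (r^-1 * (1 - r ^- 2) / (s ^+ 2 *+ 2)) i2.
  have : gauss x s (cst r^-1
           \+ (fun y => r^-1 * (1 - r ^- 2) / (s ^+ 2 *+ 2) * (y - x) ^+ 2)) <= 1.
    rewrite -[leRHS](gauss_scale x s0' r0); apply: ler_gauss.
    - exact: gauss_integrableD.
    - exact: gauss_integrable_scale.
    - move=> y /=; set w := (y - x) ^+ 2.
      rewrite (_ : _ + _ = r^-1 * (1 + (1 - r ^- 2) * w / (s ^+ 2 *+ 2))).
        by rewrite ler_wpM2l ?expR_ge1Dx// invr_ge0 ltW.
      by ring.
  rewrite gaussD// gaussZ// gauss_cst -/e -(ler_pM2l r0) mulr1.
  by congr (_ <= _); field; rewrite s0'.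
set k := e / s ^+ 2 in key.
suff -> : e = k * s ^+ 2.
  suff -> : k = 1 by rewrite mul1r.
  (* Clearing denominators exposes the factor [r - 1]; the other factor tends to [2 * (k - 1)] as
     [r] tends to 1, so [k != 1] is refuted by an [r] on the appropriate side of 1. *)
  have key2 r : 0 < r -> (r - 1) * ((r + 1) * k - 2 * r ^+ 2) <= 0.
    move=> r0; have r0' : r != 0 by rewrite gt_eqF.
    have h := key r r0.
    have : 2 * r ^+ 2 * (1 + (1 - r ^- 2) / 2 * k) <= 2 * r ^+ 2 * r.
      by rewrite ler_wpM2l// mulr_ge0// exprn_ge0// ltW.
    have -> : 2 * r ^+ 2 * (1 + (1 - r ^- 2) / 2 * k)
        = 2 * r ^+ 2 + (r ^+ 2 - 1) * k by field.
    by lra.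
  have k0 : 0 <= k.
    rewrite divr_ge0 ?sqr_ge0// -(gauss_cst x s 0); apply: ler_gauss => //.
      exact: gauss_integrable_cst.
    by move=> y; exact: sqr_ge0.
  apply/eqP; rewrite eq_le; apply/andP; split; rewrite leNgt; apply/negP => k1.
    (* With [d] at most a tenth of the gap [k - 1], the second factor of [key2] keeps the sign of
       its limit; the cap 1/2 controls the square of [d]. *)
    pose d := Num.min (1/2) ((k - 1) / 10).
    have d0 : 0 < d by rewrite lt_min; apply/andP; split; lra.
    have d1 : d <= 1/2 by rewrite ge_min lexx.
    have d2 : d <= (k - 1) / 10 by rewrite ge_min lexx orbT.
    have := key2 (1 + d) ltac:(lra).
    have : 0 < (1 + d + 1) * k - 2 * (1 + d) ^+ 2 by nra.
    by nra.
  pose d := Num.min (1/2) ((1 - k) / 10).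
  have d0 : 0 < d by rewrite lt_min; apply/andP; split; lra.
  have d1 : d <= 1/2 by rewrite ge_min lexx.
  have d2 : d <= (1 - k) / 10 by rewrite ge_min lexx orbT.
  have := key2 (1 - d) ltac:(lra).
  have : (1 - d + 1) * k - 2 * (1 - d) ^+ 2 < 0 by nra.
  by nra.
by rewrite /k divfK// sqrf_eq0.
Qed.

(** The linear term has mean zero and the quadratic one is computed exactly. Only the cubic moment
    is merely bounded, hence the sign condition on [e3] alone. It serves both for Taylor expansions
    and for integrating errors of the form [e + k * x ^+ 2]. *)
Lemma gauss_expansion x s u (c0 c1 c2 e0 e2 e3 : R) : 0 < s ->
  gauss_integrable x s u ->
  0 <= e3 ->
  (forall y, `|u y - (c0 + c1 * (y - x) + c2 * (y - x) ^+ 2)|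
     <= e0 + e2 * (y - x) ^+ 2 + e3 * `|y - x| ^+ 3) ->
  `|gauss x s u - (c0 + c2 * s ^+ 2)|
     <= e0 + e2 * s ^+ 2 + e3 * (s ^+ 3 * 264 * Num.sqrt 2).
Proof.
move=> s0 iu e30 hu.
have i1 := @gauss_integrable_moment x s 1 s0 isT.
have i2 := @gauss_integrable_moment x s 2 s0 isT.
have i3 := @gauss_integrable_norm_moment x s 3 s0 isT.
have iZ r w := @gauss_integrableZ x s w r.
have ic := gauss_integrable_cst x s.
have iP b0 b1 b2 b3 : gauss_integrable x s
    (cst b0 \+ ((fun y => b1 * (y - x) ^+ 1) \+ ((fun y => b2 * (y - x) ^+ 2)
       \+ (fun y => b3 * `|y - x| ^+ 3)))).
  by do !(apply: gauss_integrableD => //; try exact: iZ); exact: iZ.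
have gP b0 b1 b2 b3 : gauss x s
    (cst b0 \+ ((fun y => b1 * (y - x) ^+ 1) \+ ((fun y => b2 * (y - x) ^+ 2)
       \+ (fun y => b3 * `|y - x| ^+ 3))))
    = b0 + b2 * s ^+ 2 + b3 * gauss x s (fun y => `|y - x| ^+ 3).
  have j1 := iZ b1 _ i1; have j2 := iZ b2 _ i2; have j3 := iZ b3 _ i3.
  have j23 := gauss_integrableD j2 j3.
  rewrite gaussD//; last exact: gauss_integrableD.
  rewrite gaussD// gaussD// !gaussZ// gauss_cst gauss_variance//.
  rewrite (_ : gauss x s (fun y => (y - x) ^+ 1) = 0); last exact: gauss_mean.
  by rewrite mulr0 add0r addrA.
have m3 := @gauss_norm_moment_le x s 3 s0 isT.
have m3' := ler_wpM2l e30 m3.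
have hi : gauss x s u <= c0 + e0 + (c2 + e2) * s ^+ 2
    + e3 * gauss x s (fun y => `|y - x| ^+ 3).
  rewrite -(gP _ c1); apply: ler_gauss => // y /=; have := hu y.
  by rewrite ler_norml => /andP[_]; rewrite expr1; lra.
have lo : c0 - e0 + (c2 - e2) * s ^+ 2
    + (- e3) * gauss x s (fun y => `|y - x| ^+ 3) <= gauss x s u.
  rewrite -(gP _ c1); apply: ler_gauss => // y /=; have := hu y.
  by rewrite ler_norml => /andP[+ _]; rewrite expr1; lra.
by rewrite ler_norml; apply/andP; split; lra.
Qed.

End GaussianSmoothing.

(** * Composition of Gaussian steps, and the link with the normal law *)

Section GaussianSemigroup.
Context {R : realType}.
Implicit Types (x y s m r : R) (u v : R -> R).
Notation mu := (@lebesgue_measure R).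

Lemma gauss_integrable_bounded x s u (M : R) : measurable_fun setT u ->
  (forall y, `|u y| <= M) -> gauss_integrable x s u.
Proof.
move=> mu_ uM; apply: (gauss_integrable_le mu_ (v := cst M)) => //.
exact: gauss_integrable_cst.
Qed.

Lemma gauss_bounded x s u (M : R) : measurable_fun setT u ->
  (forall y, `|u y| <= M) -> `|gauss x s u| <= M.
Proof.
move=> mu_ uM; have iu := gauss_integrable_bounded x s mu_ uM.
have ic r := gauss_integrable_cst x s r.
have uM' y : - M <= u y <= M by rewrite -ler_norml.
rewrite ler_norml -{1}(gauss_cst x s (- M)) -{2}(gauss_cst x s M).
by apply/andP; split; apply: ler_gauss => // y; case/andP: (uM' y).
Qed.

Lemma measurable_normal_pdf2 s : s != 0 ->
  measurable_fun setT (fun z : R * R => normal_pdf z.1 s z.2).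
Proof.
move=> s0; apply: (eq_measurable_fun
  (fun z : R * R => normal_peak s * expR (- (z.2 - z.1) ^+ 2 / (s ^+ 2 *+ 2)))).
  by move=> z _; rewrite normal_pdfE.
apply: measurable_funM => //; apply: measurableT_comp => //.
apply: measurable_funM => //; apply: measurableT_comp => //.
by apply: measurable_funX => //; exact: measurable_funB.
Qed.

Lemma EFin_gauss x s u (M : R) : measurable_fun setT u ->
  (forall y, `|u y| <= M) ->
  (gauss x s u)%:E = (\int[mu]_y (gaussf x s u y)%:E)%E.
Proof.
move=> mu_ uM; rewrite /gauss /Rintegral fineK//.
by apply: integrable_fin_num => //; exact: gauss_integrable_bounded uM.
Qed.

Lemma measurable_gauss s u (M : R) : s != 0 -> measurable_fun setT u ->
  (forall y, `|u y| <= M) -> measurable_fun setT (fun x => gauss x s u).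
Proof.
move=> s0 mu_ uM.
have ic r := gauss_integrable_cst _ s r.
have iu x := gauss_integrable_bounded x s mu_ uM.
(* Adding [M] makes the integrand nonnegative, as Tonelli requires; the correction integrates to
   exactly [M]. *)
have -> : (fun x => gauss x s u)
    = (fun x => fine (\int[mu]_w ((u w + M) * normal_pdf x s w)%:E)%E - M).
  apply/funext => x; rewrite -[X in _ - X](gauss_cst x s M).
  rewrite (_ : fine _ = gauss x s (u \+ cst M))//.
  by rewrite gaussD// gauss_cst addrK.
apply: measurable_funB => //; apply: measurableT_comp => //.
apply: (measurable_fun_fubini_tonelli_F (m2 := mu)
  (fun z : R * R => ((u z.2 + M) * normal_pdf z.1 s z.2)%:E)).
- apply/measurable_EFinP; apply: measurable_funM; last exact: measurable_normal_pdf2.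
  by apply: measurable_funD => //; exact: measurableT_comp.
- move=> z; rewrite lee_fin mulr_ge0// ?normal_pdf_ge0//.
  by have := uM z.2; rewrite ler_norml => /andP[+ _]; lra.
Qed.

(* Completing the square: the joint density of two successive Gaussian steps is
   the density of the endpoint times that of the midpoint given the endpoint. *)
Lemma normal_pdf_bridge x y w (a b c : R) : 0 < a -> 0 < b -> 0 < c ->
  c ^+ 2 = a ^+ 2 + b ^+ 2 ->
  normal_pdf y b w * normal_pdf x a y
  = normal_pdf x c w
    * normal_pdf ((b ^+ 2 * x + a ^+ 2 * w) / c ^+ 2) (a * b / c) y.
Proof.
move=> a0 b0 c0 cab.
have ne : [/\ a != 0, b != 0, c != 0 & a * b / c != 0].
  by rewrite !gt_eqF// divr_gt0// mulr_gt0.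
case: ne => a0' b0' c0' t0'.
rewrite !normal_pdfE// mulrACA [RHS]mulrACA; congr (_ * _).
  rewrite /normal_peak -!invfM -!sqrtrM; first last.
  - by rewrite mulrn_wge0// mulr_ge0 ?sqr_ge0// pi_ge0.
  - by rewrite mulrn_wge0// mulr_ge0 ?sqr_ge0// pi_ge0.
  by congr ((Num.sqrt _)^-1); field.
rewrite /normal_fun -!expRD; congr expR.
have abn : a ^+ 2 + b ^+ 2 != 0 by rewrite -cab expf_neq0.
rewrite !expr_div_n cab; field.
by rewrite a0' b0' abn.
Qed.

(** Once Fubini has put the midpoint [y] in the inner integral, [normal_pdf_bridge] leaves there a
    probability density in [y], which integrates to 1. *)
Lemma gauss_semigroup x (a b c : R) u (M : R) : 0 < a -> 0 < b -> 0 < c ->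
  c ^+ 2 = a ^+ 2 + b ^+ 2 -> measurable_fun setT u ->
  (forall y, `|u y| <= M) ->
  gauss x a (fun y => gauss y b u) = gauss x c u.
Proof.
move=> a0 b0 c0 cab mu_ uM.
have b0' : b != 0 by rewrite gt_eqF.
have iu y s := gauss_integrable_bounded y s mu_ uM.
have mg : measurable_fun setT (fun x => gauss x b u) by exact: measurable_gauss uM.
have gM y := @gauss_bounded y b u M mu_ uM.
have pE s (s' k : R) : (\int[mu]_w (k * normal_pdf s s' w)%:E = k%:E)%E.
  under eq_integral do rewrite EFinM.
  by rewrite integralZl//= ?integral_normal_pdf ?mule1//; exact: integrable_normal_pdf.
pose F (z : R * R) := (u z.2 * normal_pdf z.1 b z.2 * normal_pdf x a z.1)%:E.
have mF : measurable_fun setT F.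
  apply/measurable_EFinP; apply: measurable_funM.
    apply: measurable_funM; last exact: measurable_normal_pdf2.
    exact: measurableT_comp.
  by apply: measurableT_comp => //; exact: measurable_normal_pdf.
have iF : (mu \x mu)%E.-integrable setT F.
  apply/integrable12ltyP => //.
  apply: (@le_lt_trans _ _ (\int[mu]_y (M * normal_pdf x a y)%:E)%E); last first.
    by rewrite pE ltry.
  apply: ge0_le_integral => //=.
  - by move=> y _; apply: integral_ge0.
  - apply: (measurable_fun_fubini_tonelli_F (m2 := mu) (abse \o F)).
      exact: measurableT_comp.
    by move=> z; exact: abse_ge0.
  - apply/measurable_EFinP; apply: measurable_funM => //.
    exact: measurable_normal_pdf.
  - move=> y _.
    apply: (@le_trans _ _ (\int[mu]_w (M * normal_pdf x a y * normal_pdf y b w)%:E)%E).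
      apply: ge0_le_integral => //=.
      + apply/measurable_EFinP; apply: measurableT_comp => //.
        apply: measurable_funM => //; apply: measurable_funM => //.
        exact: measurable_normal_pdf.
      + apply/measurable_EFinP; apply: measurable_funM => //.
        exact: measurable_normal_pdf.
      + move=> w _; rewrite lee_fin !normrM.
        rewrite (ger0_norm (normal_pdf_ge0 _ _ _)) (ger0_norm (normal_pdf_ge0 _ _ _)).
        by rewrite mulrAC !ler_wpM2r ?normal_pdf_ge0.
    by rewrite pE.
apply: EFin_inj; rewrite (EFin_gauss x c mu_ uM) (EFin_gauss x a mg gM).
transitivity (\int[mu]_y \int[mu]_w F (y, w))%E.
  apply: eq_integral => y _; rewrite /gaussf EFinM (EFin_gauss _ _ mu_ uM).
  rewrite -integralZr//; first exact: iu.
(* The right-hand side is expanded backwards, as its own integral against the law of the midpoint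
   given the endpoint [w]. *)
rewrite (Fubini iF); apply: eq_integral => w _; rewrite /gaussf -[RHS](pE
  ((b ^+ 2 * x + a ^+ 2 * w) / c ^+ 2) (a * b / c)).
apply: eq_integral => y _.
rewrite /F /=; congr EFin.
by rewrite -[LHS]mulrA -[RHS]mulrA (normal_pdf_bridge _ _ _ a0 b0 c0 cab).
Qed.

Lemma normal_expect_gauss (v : R) u (M : R) : 0 < v -> measurable_fun setT u ->
  (forall y, `|u y| <= M) ->
  normal_expect v u = gauss 0 (Num.sqrt v) u.
Proof.
move=> v0 mu_ uM; rewrite /normal_expect v0 /gauss /Rintegral; congr fine.
set s := Num.sqrt v.
have dom := normal_prob_dominates 0 s.
have iu : (normal_prob 0 s).-integrable setT (EFin \o u).
  apply: measurable_bounded_integrable => //.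
    exact: le_lt_trans (probability_le1 (normal_prob 0 s) measurableT) (ltry 1).
  exists M; split; first exact: num_real.
  by move=> N MN y _ /=; rewrite (le_trans (uM y))// ltW.
rewrite -(Radon_Nikodym_change_of_variables dom)//=.
apply: ae_eq_integral => //.
- apply: emeasurable_funM; first exact/measurable_EFinP.
  by apply: (measurable_int mu); exact: Radon_Nikodym_integrable.
- by apply/measurable_EFinP; exact: measurable_gaussf.
rewrite /gaussf; under [X in ae_eq _ _ _ X]eq_fun do rewrite EFinM.
apply: ae_eqe_mul2l.
rewrite Radon_NikodymE//=.
case: cid => /= h [h1 h2 h3].
(* The Radon-Nikodym derivative and [normal_pdf] have equal integrals over every measurable set, so
   they agree almost everywhere. *)
apply: integral_ae_eq => //=.
- by apply/measurable_EFinP; exact: measurable_normal_pdf.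
- by move=> E E01 mE; rewrite -h3.
Qed.

End GaussianSemigroup.

(** * Lindeberg replacement *)

Section IidExpectation.
Context {R : realType} {T : finType}.
Implicit Types (p : T -> R) (n : nat).

(** Same shape as [multinom_expect], with a cell as a single index, so that the two are identified
    by conversion at the end. *)
Definition iidE p n (X : {ffun 'I_n -> T} -> R) : R :=
  \sum_(s : {ffun 'I_n -> T}) (\prod_(k < n) p (s k)) * X s.

Definition walk_step {V : zmodType} p (v : T -> V) (h : V -> R) (x : V) : R :=
  \sum_c p c * h (x + v c).

Definition fcons n (c : T) (s : {ffun 'I_n -> T}) : {ffun 'I_n.+1 -> T} :=
  [ffun i => oapp s c (unlift ord0 i)].

Lemma fcons0 n c (s : {ffun 'I_n -> T}) : fcons c s ord0 = c.
Proof. by rewrite ffunE unlift_none. Qed.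

Lemma fconsS n c (s : {ffun 'I_n -> T}) k : fcons c s (lift ord0 k) = s k.
Proof. by rewrite ffunE liftK. Qed.

Lemma iidE_recl p n (X : {ffun 'I_n.+1 -> T} -> R) :
  iidE p X = \sum_c p c * iidE p (fun s => X (fcons c s)).
Proof.
rewrite /iidE.
under [RHS]eq_bigr do rewrite big_distrr/=.
rewrite pair_big/=.
rewrite (reindex (fun cs : T * {ffun 'I_n -> T} => fcons cs.1 cs.2))/=.
  apply: eq_bigr => -[c s] _ /=.
  rewrite big_ord_recl fcons0 mulrA; congr (_ * _ * _).
  by apply: eq_bigr => k _; rewrite fconsS.
exists (fun s : {ffun 'I_n.+1 -> T} => (s ord0, [ffun k => s (lift ord0 k)])).
  move=> -[c s] _ /=; rewrite fcons0; congr pair.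
  by apply/ffunP => k; rewrite ffunE fconsS.
move=> s _ /=; apply/ffunP => i; rewrite ffunE.
by case: unliftP => [j ->|->] /=; rewrite ?ffunE.
Qed.

(** Conditioning on the first draw peels off one application of the transition operator; this is how
    independence enters the operator argument. *)
Lemma iidE_sum {V : zmodType} p (v : T -> V) (h : V -> R) n x :
  iidE p (fun s : {ffun 'I_n -> T} => h (x + \sum_k v (s k)))
  = iter n (walk_step p v) h x.
Proof.
elim: n x => [|n IHn] x.
  rewrite /iidE (big_pred1 [ffun i : 'I_0 => match i with Ordinal m lt => False_rect T (notF lt) end]).
    by rewrite !big_ord0 mul1r addr0.
  by move=> s /=; apply/esym/eqP/ffunP => -[].
rewrite iidE_recl /= /walk_step; apply: eq_bigr => c _; congr (_ * _).
rewrite -IHn; apply: eq_bigr => s _; congr (_ * h _).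
rewrite big_ord_recl fcons0 addrA; congr (_ + _).
by apply: eq_bigr => k _; rewrite fconsS.
Qed.

Lemma iidED p n (X Y : {ffun 'I_n -> T} -> R) :
  iidE p (X \+ Y) = iidE p X + iidE p Y.
Proof. by rewrite /iidE -big_split; apply: eq_bigr => s _; rewrite mulrDr. Qed.

Lemma iidEZ p n (X : {ffun 'I_n -> T} -> R) (a : R) :
  iidE p (fun s => a * X s) = a * iidE p X.
Proof. by rewrite /iidE big_distrr; apply: eq_bigr => s _; rewrite mulrCA. Qed.

Lemma iidE_bigsum (I : finType) p n (X : I -> {ffun 'I_n -> T} -> R) :
  iidE p (fun s => \sum_i X i s) = \sum_i iidE p (X i).
Proof.
rewrite /iidE exchange_big/=; apply: eq_bigr => s _.
by rewrite big_distrr.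
Qed.

Section Weights.
Variable p : T -> R.
Hypotheses (p0 : forall c, 0 <= p c) (p1 : \sum_c p c = 1).

Lemma iidE_le n (X Y : {ffun 'I_n -> T} -> R) : (forall s, X s <= Y s) ->
  iidE p X <= iidE p Y.
Proof. by move=> XY; apply: ler_sum => s _; rewrite ler_wpM2l// prodr_ge0. Qed.

Lemma iidE_cst n (a : R) : iidE p (fun _ : {ffun 'I_n -> T} => a) = a.
Proof.
rewrite /iidE -big_distrl/= -[RHS]mul1r; congr (_ * _).
rewrite -(bigA_distr_bigA (fun (_ : 'I_n) c => p c))/=.
by rewrite big1.
Qed.

Lemma iidE_norm_le n (X Y : {ffun 'I_n -> T} -> R) :
  (forall s, `|X s| <= Y s) -> `|iidE p X| <= iidE p Y.
Proof.
move=> XY; apply: le_trans (ler_norm_sum _ _ _) _.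
apply: ler_sum => s _; rewrite normrM ger0_norm ?prodr_ge0//.
by rewrite ler_wpM2l// prodr_ge0.
Qed.

Lemma iidE_sqr_sum (xi : T -> R) n : \sum_c p c * xi c = 0 ->
  iidE p (fun s : {ffun 'I_n -> T} => (\sum_k xi (s k)) ^+ 2)
  = n%:R * \sum_c p c * xi c ^+ 2.
Proof.
move=> xi0; set v := \sum_c p c * xi c ^+ 2.
(* Each step adds [v] to the square, the cross term vanishing because [xi] is centered. *)
have it : forall m x, iter m (walk_step p xi) (fun x => x ^+ 2) x = x ^+ 2 + m%:R * v.
  elim=> [|m IHm] x; first by rewrite mul0r addr0.
  rewrite iterS /walk_step; under eq_bigr do rewrite IHm.
  transitivity (\sum_c ((x ^+ 2 + m%:R * v) * p c + (2 * x * (p c * xi c)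
     + p c * xi c ^+ 2))); first by apply: eq_bigr => c _; ring.
  rewrite !big_split/= -!big_distrr/= p1 xi0 -/v -(natr1 m); ring.
have := it n 0; rewrite expr0n/= add0r -iidE_sum => <-.
by apply: eq_bigr => s _; rewrite add0r.
Qed.

End Weights.
End IidExpectation.

(** * Comparison of the walk with Gaussian steps *)

Section Lindeberg.
Context {R : realType}.

(** Nothing is asked of the coefficients [a] and [b], and [M] does not depend on the base point:
    averages of translates of [h] then stay in the class with the same [M]. *)
Definition cubic_taylor (M : R) (h : R -> R) := exists a b : R -> R,
  forall x y, `|h (x + y) - (h x + a x * y + b x * y ^+ 2)| <= M * `|y| ^+ 3.

Context {T : finType}.
Variables (p xi : T -> R) (sigma : R).
Hypotheses (p0 : forall c, 0 <= p c) (p1 : \sum_c p c = 1).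
Hypotheses (xi0 : \sum_c p c * xi c = 0) (s0 : 0 < sigma).
Hypothesis xi2 : \sum_c p c * xi c ^+ 2 = sigma ^+ 2.

Let rho := \sum_c p c * `|xi c| ^+ 3.
Let K := rho + sigma ^+ 3 * 264 * Num.sqrt 2.

Section Step.
Variable t : R.
Hypothesis t0 : 0 < t.
Let step := walk_step p (fun c => t * xi c).

Lemma walk_step_bounded (B : R) h : (forall x, `|h x| <= B) ->
  forall x, `|step h x| <= B.
Proof.
move=> hB x; apply: le_trans (ler_norm_sum _ _ _) _.
rewrite -[leRHS]mul1r -p1 big_distrl/=; apply: ler_sum => c _.
by rewrite normrM ger0_norm// ler_wpM2l.
Qed.

Lemma measurable_walk_step h : measurable_fun setT h ->
  measurable_fun setT (step h).
Proof.
move=> mh; apply: measurable_sum => c; apply: measurable_funM => //.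
by apply: measurableT_comp => //; exact: measurable_funD.
Qed.

Lemma cubic_taylor_walk_step M h : cubic_taylor M h -> cubic_taylor M (step h).
Proof.
move=> [a [b hab]].
exists (fun x => \sum_c p c * a (x + t * xi c)),
  (fun x => \sum_c p c * b (x + t * xi c)) => x y.
rewrite [X in `|X|](_ : _ = \sum_c p c * (h (x + t * xi c + y)
  - (h (x + t * xi c) + a (x + t * xi c) * y + b (x + t * xi c) * y ^+ 2))).
  apply: le_trans (ler_norm_sum _ _ _) _.
  rewrite -[leRHS]mul1r -p1 big_distrl/=; apply: ler_sum => c _.
  by rewrite normrM ger0_norm// ler_wpM2l.
rewrite /step /walk_step !big_distrl/= -!big_split/= -sumrB; apply: eq_bigr => c _.
by rewrite (addrAC x y); ring.
Qed.

(** The two increments share their first two moments, so both averages of the Taylor polynomial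
    equal [m]; what is left is [M] times the third absolute moments, collected in [K]. *)
Lemma walk_step_gauss M B h x : 0 <= M -> cubic_taylor M h ->
  measurable_fun setT h -> (forall x, `|h x| <= B) ->
  `|step h x - gauss x (t * sigma) h| <= M * K * t ^+ 3.
Proof.
move=> M0 [a [b hab]] mh hB.
have ts0 : 0 < t * sigma by rewrite mulr_gt0.
set m := h x + b x * (t * sigma) ^+ 2.
have e1 : `|step h x - m| <= M * rho * t ^+ 3.
  rewrite [X in `|X|](_ : _ = \sum_c p c * (h (x + t * xi c)
    - (h x + a x * (t * xi c) + b x * (t * xi c) ^+ 2))).
    apply: le_trans (ler_norm_sum _ _ _) _.
    rewrite /rho big_distrr/= big_distrl/=; apply: ler_sum => c _.
    rewrite normrM ger0_norm// (le_trans (ler_wpM2l (p0 c) (hab x (t * xi c))))//.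
    rewrite normrM exprMn (ger0_norm (ltW t0)).
    by rewrite le_eqVlt; apply/orP; left; apply/eqP; ring.
  transitivity (step h x - (h x * \sum_c p c + (a x * t * (\sum_c p c * xi c)
    + b x * t ^+ 2 * \sum_c p c * xi c ^+ 2))).
    by rewrite p1 xi0 xi2 /m; ring.
  rewrite /step /walk_step !big_distrr/= -!big_split/= -sumrB.
  by apply: eq_bigr => c _; ring.
have e2 : `|gauss x (t * sigma) h - m|
    <= 0 + 0 * (t * sigma) ^+ 2 + M * ((t * sigma) ^+ 3 * 264 * Num.sqrt 2).
  apply: (@gauss_expansion _ _ _ _ _ (a x)) => //.
    exact: gauss_integrable_bounded hB.
  move=> y; have := hab x (y - x).
  by rewrite (_ : x + (y - x) = y) ?mul0r ?add0r//; ring.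
apply: le_trans (ler_distD m _ _) _.
rewrite [`|m - _|]distrC (le_trans (lerD e1 e2))//.
by rewrite le_eqVlt /K; apply/orP; left; apply/eqP; ring.
Qed.

Lemma walk_gauss M B h k x : 0 <= M -> cubic_taylor M h ->
  measurable_fun setT h -> (forall x, `|h x| <= B) ->
  `|iter k.+1 step h x - gauss x (t * sigma * Num.sqrt k.+1%:R) h|
  <= k.+1%:R * (M * K * t ^+ 3).
Proof.
move=> M0 hM mh hB.
have ts0 : 0 < t * sigma by rewrite mulr_gt0.
have P j : [/\ cubic_taylor M (iter j step h), measurable_fun setT (iter j step h)
    & forall x, `|iter j step h x| <= B].
  elim: j => [|j [h1 h2 h3]] //; split.
  - exact: cubic_taylor_walk_step.
  - exact: measurable_walk_step.
  - exact: walk_step_bounded.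
elim: k x => [|k IHk] x.
  by rewrite sqrtr1 mulr1 mul1r; exact: walk_step_gauss hB.
have [h1 h2 h3] := P k.+1.
have sk : 0 < Num.sqrt k.+1%:R :> R by rewrite sqrtr_gt0.
have sk2 : 0 < Num.sqrt k.+2%:R :> R by rewrite sqrtr_gt0.
have tk : 0 < t * sigma * Num.sqrt k.+1%:R by rewrite mulr_gt0.
have tk' : t * sigma * Num.sqrt k.+1%:R != 0 by rewrite gt_eqF.
have mg := measurable_gauss tk' mh hB.
have gB y := gauss_bounded y (t * sigma * Num.sqrt k.+1%:R) mh hB.
rewrite -(@gauss_semigroup _ _ (t * sigma) (t * sigma * Num.sqrt k.+1%:R) _ _ B)//.
- rewrite [iter _ _ _]iterS.
  (* The outermost walk step is exchanged first, on a function that walk steps have kept in the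
     Taylor class; the induction hypothesis then passes through the Gaussian step by sup-norm
     contraction. *)
  apply: le_trans (ler_distD (gauss x (t * sigma) (iter k.+1 step h)) _ _) _.
  have e1 := walk_step_gauss x M0 h1 h2 h3.
  have e2 : `|gauss x (t * sigma) (iter k.+1 step h
      \+ (fun y => -1 * gauss y (t * sigma * Num.sqrt k.+1%:R) h))|
      <= k.+1%:R * (M * K * t ^+ 3).
    apply: gauss_bounded.
      by apply: measurable_funD => //; exact: measurable_funM.
    by move=> y /=; rewrite mulN1r; exact: IHk.
  have ig := gauss_integrable_bounded x (t * sigma) mg gB.
  rewrite gaussD ?gaussZ// ?mulN1r in e2; first last.
  - exact: gauss_integrableZ.
  - exact: gauss_integrable_bounded h3.
  by rewrite (le_trans (lerD e1 e2))// -[in leRHS]natr1; lra.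
- by rewrite mulr_gt0.
- by rewrite !exprMn !sqr_sqrtr// -(natr1 k.+1); ring.
Qed.

End Step.

Lemma clt_smooth M B h n : 0 <= M -> cubic_taylor M h ->
  measurable_fun setT h -> (forall x, `|h x| <= B) -> (0 < n)%N ->
  `|iidE p (fun s : {ffun 'I_n -> T} => h ((Num.sqrt n%:R)^-1 * \sum_k xi (s k)))
    - gauss 0 sigma h| <= M * K / Num.sqrt n%:R.
Proof.
case: n => // n M0 hM mh hB _.
have sn : 0 < Num.sqrt n.+1%:R :> R by rewrite sqrtr_gt0.
have t0 : 0 < (Num.sqrt n.+1%:R)^-1 :> R by rewrite invr_gt0.
have := walk_gauss t0 n 0 M0 hM mh hB.
rewrite -iidE_sum mulrAC mulVf ?gt_eqF// mul1r.
under eq_fun do rewrite add0r -big_distrr/=.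
move=> /le_trans; apply.
have n2 : n.+1%:R = Num.sqrt n.+1%:R ^+ 2 :> R by rewrite sqr_sqrtr.
(* Each of the [n.+1] steps costs the cube of the step size, which is one over the square root of
   [n.+1]. *)
rewrite [X in X * _]n2 le_eqVlt; apply/orP; left; apply/eqP.
by field; rewrite gt_eqF.
Qed.

End Lindeberg.

(** * Smooth approximation of bounded continuous functions *)

Section SmoothApproximation.
Context {R : realType}.
Implicit Types (x y : R) (g h : R -> R).

(** The coefficients are the first derivative and half the second. The second derivative is
    Lipschitz with constant 6, whence the remainder constant 6/3! = 1; the proof checks this
    according to the signs of [x] and [x + y]. *)
Lemma cubic_taylor_pos3 : cubic_taylor 1 (fun x => Num.max x 0 ^+ 3).
Proof.
exists (fun x => 3 * Num.max x 0 ^+ 2), (fun x => 3 * Num.max x 0) => x y.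
rewrite mul1r -normrX ler_norml.
have [x0|/ltW x0] := leP x 0; have [xy0|/ltW xy0] := leP (x + y) 0.
- rewrite !(expr0n, mulr0, mul0r, addr0, subr0)/=.
  by rewrite -ler_norml normr0.
- rewrite !(expr0n, mulr0, mul0r, addr0, subr0)/=.
  have h : 0 <= (x + y) ^+ 3 by rewrite exprn_ge0.
  have h' : (x + y) ^+ 3 <= y ^+ 3 by rewrite lerXn2r ?nnegrE; lra.
  by rewrite ger0_norm; [apply/andP; split|]; lra.
- rewrite expr0n/= sub0r.
  have yE : y ^+ 3 = - (- y) ^+ 3 by ring.
  have h : 0 <= (- (x + y)) ^+ 3 by rewrite exprn_ge0 ?oppr_ge0.
  have h' : (- (x + y)) ^+ 3 <= (- y) ^+ 3 by rewrite lerXn2r ?nnegrE; lra.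
  rewrite (ler0_norm (x := y ^+ 3)); last by rewrite yE; lra.
  by apply/andP; split; nra.
- rewrite (_ : _ - _ = y ^+ 3); last by ring.
  by rewrite -ler_norml.
Qed.

Lemma measurable_pos3 : measurable_fun setT (fun x => Num.max x 0 ^+ 3).
Proof. by apply: measurable_funX => //; exact: measurable_maxr. Qed.

Lemma cubic_taylorD (M N : R) g h : cubic_taylor M g -> cubic_taylor N h ->
  cubic_taylor (M + N) (fun x => g x + h x).
Proof.
move=> [a [b hab]] [a' [b' hab']].
exists (fun x => a x + a' x), (fun x => b x + b' x) => x y.
rewrite [X in `|X|](_ : _ = (g (x + y) - (g x + a x * y + b x * y ^+ 2))
  + (h (x + y) - (h x + a' x * y + b' x * y ^+ 2))); last by ring.
by rewrite mulrDl (le_trans (ler_normD _ _))// lerD.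
Qed.

Lemma cubic_taylor_affine (M : R) h (r k l : R) : cubic_taylor M h ->
  cubic_taylor (`|r| * M * `|k| ^+ 3) (fun x => r * h (k * x + l)).
Proof.
move=> [a [b hab]].
exists (fun x => r * a (k * x + l) * k), (fun x => r * b (k * x + l) * k ^+ 2) => x y.
have := hab (k * x + l) (k * y).
rewrite (_ : k * x + l + k * y = k * (x + y) + l); last by ring.
set D := (X in `|X|) => hD.
rewrite [X in `|X|](_ : _ = r * D); last by rewrite /D; ring.
rewrite normrM (le_trans (ler_wpM2l _ hD))// normrM le_eqVlt.
by apply/orP; left; apply/eqP; ring.
Qed.

(* The integral of the cubic B-spline supported on [0, 1]. *)
Definition smoothstep x : R :=
  6^-1 * Num.max (3 * x + 0) 0 ^+ 3
  + (- 2^-1 * Num.max (3 * x + -1) 0 ^+ 3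
  + (2^-1 * Num.max (3 * x + -2) 0 ^+ 3
  + - 6^-1 * Num.max (3 * x + -3) 0 ^+ 3)).

Lemma cubic_taylor_smoothstep : exists2 M, 0 <= M & cubic_taylor M smoothstep.
Proof.
have P r l := cubic_taylor_affine r 3 l cubic_taylor_pos3.
eexists; last first.
  by apply: cubic_taylorD (P _ _) (cubic_taylorD (P _ _) (cubic_taylorD (P _ _) (P _ _))).
by rewrite !addr_ge0// !mulr_ge0.
Qed.

Lemma measurable_smoothstep : measurable_fun setT smoothstep.
Proof.
have P (r l : R) : measurable_fun setT (fun x => r * Num.max (3 * x + l) 0 ^+ 3).
  apply: measurable_funM => //.
  apply: (measurableT_comp measurable_pos3).
  by apply: measurable_funD => //; exact: measurable_funM.
by do 3 apply: measurable_funD => //.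
Qed.

Lemma smoothstep_le0 x : x <= 0 -> smoothstep x = 0.
Proof.
by move=> x0; rewrite /smoothstep !max_r; lra.
Qed.

Lemma smoothstep_ge1 x : 1 <= x -> smoothstep x = 1.
Proof. by move=> x1; rewrite /smoothstep !max_l; try lra; field. Qed.

Lemma smoothstep_itv x : 0 <= smoothstep x <= 1.
Proof.
have [x0|x0] := lerP x 0; first by rewrite smoothstep_le0// lexx ler01.
have [x1|x1] := lerP 1 x; first by rewrite smoothstep_ge1// lexx ler01.
rewrite /smoothstep [X in 6^-1 * X ^+ 3]max_l; last lra.
rewrite [X in - 6^-1 * X ^+ 3]max_r; last lra.
have [h1|h1] := lerP (3 * x + -1) 0; have [h2|h2] := lerP (3 * x + -2) 0;
  try (exfalso; lra).
- have : 0 <= (3 * x) ^+ 3 by rewrite exprn_ge0; lra.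
  have : (3 * x) ^+ 3 <= 1 by rewrite exprn_ile1; lra.
  by move=> ? ?; apply/andP; split; lra.
- have -> : 6^-1 * (3 * x + 0) ^+ 3 + (- 2^-1 * (3 * x + -1) ^+ 3
     + (2^-1 * 0 ^+ 3 + - 6^-1 * 0 ^+ 3))
     = 6^-1 + 2^-1 * (3 * x - 1) + 2^-1 * (3 * x - 1) ^+ 2 - 3^-1 * (3 * x - 1) ^+ 3.
    by field.
  set w := 3 * x - 1; have w0 : 0 < w by rewrite /w; lra.
  have w1 : w <= 1 by rewrite /w; lra.
  have w2 : w ^+ 2 <= w by rewrite expr2; nra.
  have w3 : w ^+ 3 <= w ^+ 2 by rewrite exprS; nra.
  have w4 : 0 <= w ^+ 3 by rewrite exprn_ge0// ltW.
  by apply/andP; split; nra.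
(* On the last third the formula is the reflection of the first one under exchange of [x] with
   [1 - x]. *)
- have -> : 6^-1 * (3 * x + 0) ^+ 3 + (- 2^-1 * (3 * x + -1) ^+ 3
     + (2^-1 * (3 * x + -2) ^+ 3 + - 6^-1 * 0 ^+ 3))
     = 1 - 6^-1 * (3 - 3 * x) ^+ 3.
    by field.
  have : 0 <= (3 - 3 * x) ^+ 3 by rewrite exprn_ge0; lra.
  have : (3 - 3 * x) ^+ 3 <= 1 by rewrite exprn_ile1; lra.
  by move=> ? ?; apply/andP; split; lra.
Qed.

(** Nodes are added one at a time: [h] is constant beyond its last node, so one more smoothstep
    moves it to the next value of [g]. On each cell [h] is a convex combination of two node values,
    which keeps both bounds. [M] may grow with the grid, since the grid is fixed before the sample
    size tends to infinity. *)
Lemma interpolate (B e eta a : R) g (N : nat) : 0 < eta ->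
  (forall x, `|g x| <= B) ->
  (forall x y, a <= x <= a + N%:R * eta -> `|x - y| <= eta -> `|g x - g y| <= e) ->
  exists h, exists M : R, [/\ 0 <= M, cubic_taylor M h, measurable_fun setT h,
    forall x, `|h x| <= B &
    (forall x, a + N%:R * eta <= x -> h x = g (a + N%:R * eta)) /\
    (forall x, a <= x <= a + N%:R * eta -> `|h x - g x| <= e)].
Proof.
move=> eta0 gB; elim: N => [|N IHN] osc.
  exists (cst (g a)), 0; split=> //=.
  - by exists (cst 0), (cst 0) => x y; rewrite /cst !mul0r !addr0 subrr normr0.
  - split=> x; first by rewrite mul0r addr0.
    rewrite mul0r addr0 -eq_le => /eqP <-; apply: osc.
      by rewrite lexx lerDl mulr_ge0// ltW.
    by rewrite subrr normr0 ltW.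
have NS : a + N.+1%:R * eta = a + N%:R * eta + eta by rewrite -natr1; ring.
have [x y xa xy|h [M [M0 hM mh hB [h1 h2]]]] := IHN.
  by apply: osc => //; rewrite NS; lra.
have [MS MS0 SM] := cubic_taylor_smoothstep.
set b := a + N%:R * eta in h1 h2 osc NS *.
have ab : a <= b by rewrite lerDl mulr_ge0// ltW.
pose r := g (b + eta) - g b.
exists (fun x => h x + r * smoothstep (eta^-1 * x + - (b / eta))).
exists (M + `|r| * MS * `|eta^-1| ^+ 3).
have arg x : eta^-1 * x + - (b / eta) = (x - b) / eta by ring.
have S0 x : x <= b -> smoothstep (eta^-1 * x + - (b / eta)) = 0.
  move=> xb; rewrite arg smoothstep_le0// pmulr_lle0 ?invr_gt0//; lra.
have S1 x : b + eta <= x -> smoothstep (eta^-1 * x + - (b / eta)) = 1.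
  move=> xb; rewrite arg smoothstep_ge1// ler_pdivlMr// mul1r; lra.
have cvx x : b <= x -> let S := smoothstep (eta^-1 * x + - (b / eta)) in
    h x + r * S = (1 - S) * g b + S * g (b + eta).
  by move=> bx /=; rewrite h1// /r; ring.
split.
- by rewrite addr_ge0// !mulr_ge0.
- by apply: cubic_taylorD => //; exact: cubic_taylor_affine.
- apply: measurable_funD => //; apply: measurable_funM => //.
  apply: (measurableT_comp measurable_smoothstep).
  by apply: measurable_funD => //; exact: measurable_funM.
- move=> x; have [xb|/ltW xb] := leP x b; first by rewrite S0// mulr0 addr0.
  rewrite cvx//; set S := smoothstep _.
  have /andP[s0 s1] : 0 <= S <= 1 by exact: smoothstep_itv.
  have := gB b; have := gB (b + eta); rewrite !ler_norml => /andP[? ?] /andP[? ?].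
  by apply/andP; split; nra.
- rewrite NS; split => x.
    by move=> xb; rewrite cvx ?S1//; [ring|lra].
  move=> /andP[ax xb]; have [xb'|/ltW xb'] := leP x b.
    by rewrite S0// mulr0 addr0 h2// ax.
  rewrite cvx//; set S := smoothstep _.
  have /andP[s0 s1] : 0 <= S <= 1 by exact: smoothstep_itv.
  have xI : a <= x <= a + N.+1%:R * eta by rewrite NS -/b; lra.
  have := osc x b xI; have := osc x (b + eta) xI.
  rewrite !ler_norml => H1 H2.
  have /andP[? ?] : - e <= g x - g (b + eta) <= e by apply: H1; lra.
  have /andP[? ?] : - e <= g x - g b <= e by apply: H2; lra.
  by apply/andP; split; nra.
Qed.

(** Only [x] is confined to the segment. The compactness argument therefore covers the segment by
    base points [x] while quantifying over every nearby [y]. *)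
Lemma uniform_modulus g (A e : R) : continuous g -> 0 < e ->
  exists2 eta, 0 < eta &
    forall x y, - A <= x <= A -> `|x - y| <= eta -> `|g x - g y| <= e.
Proof.
move=> cg e0.
have /compact_near_coveringP/(_ R 0^'+) := @segment_compact R (- A) A.
move=> /(_ (fun eta x => forall y, `|x - y| <= eta -> `|g x - g y| <= e) _).
move=> [x _|].
  have /cvgrPdist_lt/(_ (e / 2)) := cg x.
  rewrite divr_gt0// => /(_ isT) [d /= d0 hd].
  (* Half radii: a point within [eta] of the ball still lies within [d] of its center. *)
  exists (ball x (d / 2), [set eta | 0 < eta < d / 2]).
    split; first by apply: nbhsx_ballx; rewrite divr_gt0.
    exists (d / 2) => /=; first by rewrite divr_gt0.
    move=> z /=; rewrite sub0r normrN => + z0; rewrite gtr0_norm// => zd.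
    by rewrite z0 zd.
  move=> [x' eta] /= [xx' /andP[eta0 etad]] y xy.
  have h1 : `|g x - g x'| < e / 2.
    by apply: hd; rewrite /ball /= in xx' *; lra.
  have h2 : `|g x - g y| < e / 2.
    apply: hd; rewrite /ball /= in xx' *.
    by apply: le_lt_trans (ler_distD x' _ _) _; lra.
  apply: le_trans (ler_distD (g x) _ _) _; rewrite (distrC (g x')); lra.
move=> d /= d0 hd; exists (d / 2); first by rewrite divr_gt0.
move=> x y xA; apply: (hd (d / 2)) => /=.
- by rewrite sub0r normrN gtr0_norm ?divr_gt0//; lra.
- by rewrite divr_gt0.
- by rewrite in_itv.
Qed.

Lemma smooth_approx g (B e k : R) : continuous g -> (forall x, `|g x| <= B) ->
  0 < e -> 0 < k ->
  exists h, exists M : R, [/\ 0 <= M, cubic_taylor M h, measurable_fun setT h,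
    forall x, `|h x| <= B &
    forall x, `|h x - g x| <= e + k * x ^+ 2].
Proof.
move=> cg gB e0 k0.
have B0 : 0 <= B by apply: le_trans (gB 0).
(* Outside [[-A, A]] the term [k * x ^+ 2] exceeds [2 * B], the trivial bound on the difference. *)
pose A := Num.sqrt (2 * B / k).
have A2 : A ^+ 2 = 2 * B / k by rewrite sqr_sqrtr// divr_ge0 ?mulr_ge0// ltW.
have A0 : 0 <= A by exact: sqrtr_ge0.
(* The margin 1 absorbs the last cell: a grid of mesh at most 1 started at [- A] covers the segment
   and ends before [A + 1]. *)
have [eta eta0 osc] := uniform_modulus (A + 1) cg e0.
pose d := Num.min eta 1.
have d0 : 0 < d by rewrite lt_min eta0 ltr01.
pose N := (Num.truncn (2 * A / d)).+1.
have dN : 2 * A < N%:R * d.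
  by rewrite -ltr_pdivrMr// /N truncnS_gt.
have dN' : N%:R * d <= 2 * A + 1.
  rewrite /N -natr1 mulrDl mul1r lerD//; last by rewrite ge_min lexx orbT.
  by rewrite -ler_pdivlMr// truncn_le// divr_ge0// ?mulr_ge0// ltW.
have [x y xA xy|h [M [M0 hM mh hB [_ hg]]]] := @interpolate B e d (- A) g N d0 gB.
  apply: osc; first by lra.
  by rewrite (le_trans xy)// ge_min lexx.
exists h, M; split=> // x.
have [xA|xA] := boolP (- A <= x <= A).
  apply: le_trans (hg x _) _; first by lra.
  by rewrite lerDl mulr_ge0 ?sqr_ge0// ltW.
apply: (@le_trans _ _ (2 * B)).
  rewrite (le_trans (ler_normB _ _))//; have := gB x; have := hB x; lra.
have : A ^+ 2 <= x ^+ 2.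
  rewrite -(real_normK (num_real x)) lerXn2r ?nnegrE//.
  by rewrite -ler_norml -ltNge in xA; exact: ltW.
rewrite A2 ler_pdivrMr// mulrC; lra.
Qed.

End SmoothApproximation.

(** * Gradients *)

Section Gradient.
Context {R : realType} {T : finType}.
Implicit Types (p q a b : T -> R) (F G : (T -> R) -> R).

(** Fréchet differentiability at the single point [p], with closeness in sup norm and the error in
    l1 norm; these are equivalent norms, [T] being finite. *)
Definition is_gradient p F a := forall e : R, 0 < e ->
  exists2 d : R, 0 < d & forall q, (forall c, `|q c - p c| <= d) ->
    `|F q - F p - \sum_c a c * (q c - p c)| <= e * \sum_c `|q c - p c|.

Lemma is_gradient_eq p F a b : (forall c, a c = b c) ->
  is_gradient p F a -> is_gradient p F b.
Proof. by move=> ab; have -> : b = a by apply/funext => c. Qed.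

Lemma is_gradient_near p F G a (d : R) : 0 < d ->
  (forall q, (forall c, `|q c - p c| <= d) -> F q = G q) ->
  is_gradient p F a -> is_gradient p G a.
Proof.
move=> d0 FG gF e e0; have [d' d'0 hF] := gF e e0.
exists (Num.min d d'); first by rewrite lt_min d0.
move=> q hq; rewrite -!FG.
- by apply: hF => c; rewrite (le_trans (hq c))// ge_min lexx orbT.
- by move=> c; rewrite subrr normr0 ltW.
- by move=> c; rewrite (le_trans (hq c))// ge_min lexx.
Qed.

Lemma is_gradient_coord p c0 :
  is_gradient p (fun q => q c0) (fun c => (c == c0)%:R).
Proof.
move=> e e0; exists 1 => // q _; rewrite (bigD1 c0)//= eqxx mul1r big1.
  by rewrite addr0 subrr normr0 mulr_ge0 ?sumr_ge0// ltW.
by move=> c /negbTE ->; rewrite mul0r.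
Qed.

Lemma is_gradient_cst p (k : R) : is_gradient p (fun=> k) (fun=> 0).
Proof.
move=> e e0; exists 1 => // q _; rewrite subrr sub0r normrN big1 ?normr0.
  by rewrite mulr_ge0 ?sumr_ge0// ltW.
by move=> c _; rewrite mul0r.
Qed.

Lemma is_gradientD p F G a b : is_gradient p F a -> is_gradient p G b ->
  is_gradient p (fun q => F q + G q) (fun c => a c + b c).
Proof.
move=> gF gG e e0; have e20 : 0 < e / 2 by rewrite divr_gt0.
have [d d0 hF] := gF _ e20; have [d' d'0 hG] := gG _ e20.
exists (Num.min d d'); first by rewrite lt_min d0.
move=> q hq.
have hqF : forall c, `|q c - p c| <= d.
  by move=> c; rewrite (le_trans (hq c))// ge_min lexx.
have hqG : forall c, `|q c - p c| <= d'.
  by move=> c; rewrite (le_trans (hq c))// ge_min lexx orbT.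
under eq_bigr do rewrite mulrDl.
rewrite big_split/= [X in `|X|](_ : _ = (F q - F p - \sum_c a c * (q c - p c))
  + (G q - G p - \sum_c b c * (q c - p c))); last by ring.
apply: le_trans (ler_normD _ _) _.
by have := hF q hqF; have := hG q hqG; lra.
Qed.

Lemma is_gradient_sum (I : finType) p (F : I -> (T -> R) -> R) (a : I -> T -> R) :
  (forall i, is_gradient p (F i) (a i)) ->
  is_gradient p (fun q => \sum_i F i q) (fun c => \sum_i a i c).
Proof.
move=> gF; elim: (index_enum I) => [|i s IHs].
  apply: (is_gradient_eq (a := fun=> 0)); first by move=> c; rewrite big_nil.
  by under eq_fun do rewrite big_nil; exact: is_gradient_cst.
under eq_fun do rewrite big_cons.
apply: (is_gradient_eq (a := fun c => a i c + \sum_(j <- s) a j c)).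
  by move=> c; rewrite big_cons.
exact: is_gradientD.
Qed.

Lemma is_gradient_lipschitz p F a : is_gradient p F a ->
  exists2 K : R, 0 <= K & exists2 d : R, 0 < d & forall q,
    (forall c, `|q c - p c| <= d) -> `|F q - F p| <= K * \sum_c `|q c - p c|.
Proof.
move=> gF; have [d d0 hF] := gF 1 ltr01.
exists (1 + \sum_c `|a c|); first by rewrite addr_ge0 ?sumr_ge0.
exists d => // q /hF; set L := \sum_c a c * _; set S := \sum_c `|q c - p c| => h.
have hL : `|L| <= (\sum_c `|a c|) * S.
  apply: le_trans (ler_norm_sum _ _ _) _; rewrite big_distrl/=.
  apply: ler_sum => c _; rewrite normrM ler_wpM2l//.
  by rewrite /S (bigD1 c)//= lerDl sumr_ge0.
rewrite -(subrK L (F q - F p)) (le_trans (ler_normD _ _))// mulrDl.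
by rewrite lerD.
Qed.

Lemma is_gradient_continuous p F a (e : R) : 0 < e -> is_gradient p F a ->
  exists2 d : R, 0 < d & forall q,
    (forall c, `|q c - p c| <= d) -> `|F q - F p| <= e.
Proof.
move=> e0 /is_gradient_lipschitz[K K0 [d d0 h]].
have k0 : 0 < K * #|T|%:R + 1 by rewrite ltr_wpDl// mulr_ge0.
exists (Num.min d (e / (K * #|T|%:R + 1))); first by rewrite lt_min d0 divr_gt0.
move=> q hq.
have hqd : forall c, `|q c - p c| <= d.
  by move=> c; rewrite (le_trans (hq c))// ge_min lexx.
apply: le_trans (h q hqd) _.
apply: (@le_trans _ _ (K * \sum_(c : T) (e / (K * #|T|%:R + 1)))).
  rewrite ler_wpM2l// ler_sum// => c _.
  by rewrite (le_trans (hq c))// ge_min lexx orbT.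
rewrite sumr_const -[_ *+ _]mulr_natr.
rewrite [leLHS](_ : _ = e * ((K * #|T|%:R) / (K * #|T|%:R + 1))); last by ring.
by rewrite ler_piMr ?(ltW e0)// ler_pdivrMr// mul1r lerDl.
Qed.

(** Carathéodory's form of the derivative writes the increment of [phi] as [g (F q) * (F q - F p)]
    with [g] continuous at [F p], so there is no division by an increment that may vanish. *)
Lemma is_gradient_comp p F a (phi : R -> R) (l : R) : is_gradient p F a ->
  is_derive (F p) 1 phi l ->
  is_gradient p (fun q => phi (F q)) (fun c => l * a c).
Proof.
move=> gF /is_derive1_caratheodory[g [hg cg gl]] e e0.
have [K K0 [d1 d10 lip]] := is_gradient_lipschitz gF.
(* One half of [e] for each factor that is replaced; the added 1 keeps the denominators positive. *)
pose e1 := e / 2 / (K + 1); pose e2 := e / 2 / (`|l| + 1).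
have aux x : 0 <= x -> e / 2 / (x + 1) * x <= e / 2.
  move=> x0; rewrite -mulrA ler_piMr//; first by rewrite ltW ?divr_gt0.
  by rewrite mulrC ler_pdivrMr ?mul1r ?lerDl// ltr_wpDl.
have e10 : 0 < e1 by rewrite !divr_gt0// ltr_wpDl.
have e20 : 0 < e2 by rewrite !divr_gt0// ltr_wpDl.
have /cvgrPdist_le/(_ e1 e10)[d2 /= d20 gd] := cg.
have [d3 d30 cF] : exists2 d : R, 0 < d & forall q,
    (forall c, `|q c - p c| <= d) -> `|F q - F p| <= d2 / 2.
  by apply: is_gradient_continuous gF; rewrite divr_gt0.
have [d4 d40 hF] := gF e2 e20.
pose d := Num.min (Num.min d1 d3) d4.
exists d; first by rewrite !lt_min d10 d30.
move=> q hq.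
have h1 c : `|q c - p c| <= d1.
  by rewrite (le_trans (hq c))// !ge_min lexx.
have h3 c : `|q c - p c| <= d3.
  by rewrite (le_trans (hq c))// !ge_min lexx orbT.
have h4 c : `|q c - p c| <= d4.
  by rewrite (le_trans (hq c))// !ge_min lexx !orbT.
have {h1} H1 := lip q h1; have {h4} H4 := hF q h4; have {h3} H3 := cF q h3.
have G1 : `|g (F q) - l| <= e1.
  rewrite -gl distrC; apply: gd => /=; rewrite distrC (le_lt_trans H3)//; lra.
under eq_bigr do rewrite -mulrA.
rewrite -big_distrr/= hg; set L := \sum_c a c * _ in H4 *.
set S := \sum_c _ in H1 H4 *.
rewrite [X in `|X|](_ : _ = (g (F q) - l) * (F q - F p) + l * (F q - F p - L));
  last by ring.
have S0 : 0 <= S by exact: sumr_ge0.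
apply: le_trans (ler_normD _ _) _; rewrite !normrM.
have : `|g (F q) - l| * `|F q - F p| <= e1 * (K * S) by apply: ler_pM.
have : `|l| * `|F q - F p - L| <= `|l| * (e2 * S) by rewrite ler_wpM2l.
have : e1 * (K * S) <= e / 2 * S.
  by rewrite mulrA ler_wpM2r// aux.
have : `|l| * (e2 * S) <= e / 2 * S.
  by rewrite mulrCA mulrA ler_wpM2r// aux.
lra.
Qed.

Lemma is_gradientZ p F a (k : R) : is_gradient p F a ->
  is_gradient p (fun q => k * F q) (fun c => k * a c).
Proof.
move=> gF; apply: (is_gradient_comp (phi := fun x => k * x) gF).
have := is_deriveZ (f := id) k (is_derive_id (F p) (1 : R)).
by rewrite [k *: _]mulr1.
Qed.

(* Polarization reduces products to the chain rule for the square. *)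
Lemma is_gradientM p F G a b : is_gradient p F a -> is_gradient p G b ->
  is_gradient p (fun q => F q * G q) (fun c => F p * b c + G p * a c).
Proof.
move=> gF gG.
have sq H h : is_gradient p H h ->
    is_gradient p (fun q => H q ^+ 2) (fun c => 2 * H p * h c).
  move=> gH; apply: (is_gradient_comp (phi := fun x => x ^+ 2) gH).
  have := is_deriveX (f := id) 2 (is_derive_id (H p) (1 : R)).
  by rewrite [_ *: _]mulr1 expr1.
have gD := sq _ _ (is_gradientD gF gG).
have gB := sq _ _ (is_gradientD gF (is_gradientZ (-1) gG)).
have := is_gradientD (is_gradientZ 4^-1 gD) (is_gradientZ (- 4^-1) gB).
rewrite [X in is_gradient p X _](_ : _ = (fun q => F q * G q)); last first.
  by apply/funext => q; field.
by apply: is_gradient_eq => c; field.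
Qed.

Lemma is_gradientV p F a : F p != 0 -> is_gradient p F a ->
  is_gradient p (fun q => (F q)^-1) (fun c => - (F p) ^- 2 * a c).
Proof.
move=> Fp gF; apply: (is_gradient_comp (phi := fun x => x^-1) gF).
have := is_deriveV (f := id) Fp (is_derive_id (F p) (1 : R)).
by rewrite [_ *: _]mulr1.
Qed.

Lemma is_gradient_powR p F G a b : 0 < F p ->
  is_gradient p F a -> is_gradient p G b ->
  is_gradient p (fun q => powR (F q) (G q))
    (fun c => powR (F p) (G p) * (b c * ln (F p) + G p * a c / F p)).
Proof.
move=> Fp gF gG.
have gln := is_gradient_comp (phi := @ln R) gF (is_derive1_ln Fp).
have gE := is_gradient_comp (phi := @expR R) (is_gradientM gG gln) (is_derive_expR _).
have Fp2 : 0 < F p / 2 by rewrite divr_gt0.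
(* [powR] agrees with [expR (G * ln F)] away from a zero base, and near [p] the base stays above
   [F p / 2] up to equality. *)
have [d d0 hd] := is_gradient_continuous Fp2 gF.
have H : forall q, (forall c, `|q c - p c| <= d) ->
    expR (G q * ln (F q)) = powR (F q) (G q).
  move=> q /hd; rewrite ler_norml => /andP[h _].
  by rewrite /powR gt_eqF//; lra.
have := is_gradient_near d0 H gE; apply: is_gradient_eq => c.
by rewrite -H => [|?]; [ring|rewrite subrr normr0 ltW].
Qed.

(* The gradients are given in logarithmic form F i p * a i. *)
Lemma is_gradient_prod (I : finType) p (F : I -> (T -> R) -> R) (a : I -> T -> R) :
  (forall i, is_gradient p (F i) (fun c => F i p * a i c)) ->
  is_gradient p (fun q => \prod_i F i q)
    (fun c => (\prod_i F i p) * \sum_i a i c).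
Proof.
move=> gF; elim: (index_enum I) => [|i s IHs].
  apply: (is_gradient_eq (a := fun=> 0)); first by move=> c; rewrite !big_nil mulr0.
  by under eq_fun do rewrite big_nil; exact: is_gradient_cst.
under eq_fun do rewrite big_cons.
have := is_gradientM (gF i) IHs.
by apply: is_gradient_eq => c; rewrite !big_cons; ring.
Qed.

End Gradient.

(** * The gradient of [PhiGf] *)

Section GradientPhi.
Context {R : realType} {nR nC : nat}.
Variables (p : 'I_nR -> 'I_nC -> R) (f : R -> R).
Hypotheses (fcol : forall j, derivable f (colm p j) 1)
  (frow : forall i j, derivable f (p i j / rowm p i) 1)
  (rowp : forall i, 0 < rowm p i)
  (Gp : forall i, 0 < - \sum_(t < nC) f (p i t / rowm p i))
  (Sp : \sum_(t < nC) f (colm p t) != 0).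

Let P (c : 'I_nR * 'I_nC) := p c.1 c.2.
Let C (q : 'I_nR * 'I_nC -> R) i j := q (i, j).

Let fderive x : derivable f x 1 -> is_derive x 1 f (derive1 f x).
Proof. by move=> df; rewrite derive1E; exact: derivableP. Qed.

Lemma is_gradient_rowm i :
  is_gradient P (fun q => rowm (C q) i) (fun c => (c.1 == i)%:R).
Proof.
have := is_gradient_sum (fun l : 'I_nC => is_gradient_coord P (i, l)).
apply: is_gradient_eq => -[k l] /=.
rewrite (bigD1 l)//= big1; first by rewrite addr0 xpair_eqE eqxx andbT.
by move=> j jl; rewrite xpair_eqE eq_sym [l == j]eq_sym (negbTE jl) andbF.
Qed.

Lemma is_gradient_colm j :
  is_gradient P (fun q => colm (C q) j) (fun c => (c.2 == j)%:R).
Proof.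
have := is_gradient_sum (fun k : 'I_nR => is_gradient_coord P (k, j)).
apply: is_gradient_eq => -[k l] /=.
rewrite (bigD1 k)//= big1; first by rewrite addr0 xpair_eqE eqxx.
by move=> i ik; rewrite xpair_eqE [k == i]eq_sym (negbTE ik).
Qed.

Lemma is_gradient_col_entropy :
  is_gradient P (fun q => - \sum_(j < nC) f (colm (C q) j))
    (fun c => - derive1 f (colm p c.2)).
Proof.
have g j := is_gradient_comp (is_gradient_colm j) (fderive (@fcol j)).
have := is_gradientZ (-1) (is_gradient_sum g).
under eq_fun do rewrite mulN1r.
apply: is_gradient_eq => c; rewrite mulN1r; congr (- _).
rewrite (bigD1 c.2)//= eqxx mulr1 big1 ?addr0// => j jc.
by rewrite eq_sym (negbTE jc) mulr0.
Qed.

(** A cell of row [i] acts through its own numerator, which gives the single derivative, and through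
    the row total, which moves every ratio of the row and gives the sum. *)
Lemma is_gradient_row_entropy i :
  is_gradient P (fun q => - \sum_(t < nC) f (C q i t / rowm (C q) i))
    (fun c => (c.1 == i)%:R / rowm p i *
      (\sum_(t < nC) p i t / rowm p i * derive1 f (p i t / rowm p i)
       - derive1 f (p i c.2 / rowm p i))).
Proof.
have ri : rowm p i != 0 by rewrite gt_eqF.
have gV := is_gradientV (F := fun q => rowm (C q) i) ri (is_gradient_rowm i).
have g t := is_gradient_comp (phi := f)
  (is_gradientM (is_gradient_coord P (i, t)) gV) (fderive (@frow i t)).
have := is_gradientZ (-1) (is_gradient_sum g).
under eq_fun do rewrite mulN1r.
apply: is_gradient_eq => -[k l] /=.
rewrite mulN1r -[RHS]opprK; congr (- _).
rewrite -mulrN opprB mulrBr big_distrr/=.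
under eq_bigr => t _ do rewrite mulrDr.
rewrite big_split/= addrC; congr (_ + _).
  rewrite (bigD1 l)//= big1 ?addr0.
    rewrite xpair_eqE eqxx andbT; have [_|_] := eqVneq k i; last by rewrite !(mulr0,mul0r).
    by rewrite mulr1 mul1r mulrC.
  by move=> t tl; rewrite xpair_eqE [l == t]eq_sym (negbTE tl) andbF !mulr0.
rewrite -sumrN; apply: eq_bigr => t _.
by rewrite -[rowm (C P) i]/(rowm p i) -[P (i, t)]/(p i t); field.
Qed.

(** With [Q] the product and [S] the sum of [f] over the column marginals, the measure is
    [1 + Q / S]. Since [epsf] is the logarithmic derivative of [Q], its gradient is
    [Q * epsf / S - Q * f' / S ^+ 2], and [- Q / S ^+ 2] factors out. *)
Lemma is_gradient_PhiGf :
  is_gradient P (fun q => PhiGf f (C q))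
    (fun c => - (deltaf f p * Deltaf f p c.1 c.2)).
Proof.
have S0 : - \sum_(t < nC) f (colm p t) != 0 by rewrite oppr_eq0.
have gG i := is_gradient_powR (Gp i) (is_gradient_row_entropy i) (is_gradient_rowm i).
have gP : is_gradient P (fun q => \prod_(i < nR)
    powR (- \sum_(j < nC) f (C q i j / rowm (C q) i)) (rowm (C q) i))
    (fun c => (\prod_(i < nR) powR (- \sum_(j < nC) f (p i j / rowm p i)) (rowm p i))
       * epsf f p c.1 c.2).
  have := is_gradient_prod gG; apply: is_gradient_eq => c; congr (_ * _).
  rewrite (bigD1 c.1)//= eqxx [X in _ + X = _]big1 ?addr0; last first.
    by move=> i ic; rewrite eq_sym (negbTE ic) !(mul0r,mulr0) addr0.
  rewrite /epsf -[P]/(fun c => p c.1 c.2) mul1r; congr (_ + _).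
  rewrite -[rowm (C _) _]/(rowm p c.1).
  under [X in _ = (X + _) / _]eq_bigr do rewrite mulNr.
  have Fn := Gp c.1; rewrite oppr_gt0 in Fn.
  have ri := rowp c.1; rewrite sumrN /C /=.
  set a := \sum_(t < nC) _; set b := \sum_(t < nC) f _ in Fn *; set d : R := derive1 _ _.
  have bn : b != 0 by rewrite lt_eqF.
  have rn : rowm p c.1 != 0 by rewrite gt_eqF.
  by field; rewrite ?bn ?rn.
have gN := is_gradientD is_gradient_col_entropy (is_gradientZ (-1) gP).
have := is_gradientM gN (is_gradientV S0 is_gradient_col_entropy).
rewrite [X in is_gradient P X _](_ : _ = (fun q => PhiGf f (C q))); last first.
  by apply/funext => q; rewrite /PhiGf mulN1r.
apply: is_gradient_eq => c; rewrite /deltaf /Deltaf -[P]/(fun c => p c.1 c.2) /C /=.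
set Q := \prod_(i < nR) _; set S := \sum_(t < nC) f (colm p t).
have Sn : S != 0 := Sp.
by field.
Qed.

End GradientPhi.

(** * Central limit theorem and delta method *)

Section CentralLimit.
Context {R : realType} {T : finType}.
Implicit Types (g : R -> R) (p : T -> R).

(** The trivial bound [2 * B] is paid by [k * x ^+ 2] when [x] is large and by [k' * (y - x) ^+ 2]
    when the points are far apart; otherwise uniform continuity gives [e]. *)
Lemma modulus_quadratic g (B e k : R) : continuous g -> (forall x, `|g x| <= B) ->
  0 < e -> 0 < k -> exists2 k' : R, 0 <= k' &
    forall x y, `|g y - g x| <= e + k * x ^+ 2 + k' * (y - x) ^+ 2.
Proof.
move=> cg gB e0 k0.
have B0 : 0 <= B by apply: le_trans (gB 0).
pose A := Num.sqrt (2 * B / k).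
have A2 : A ^+ 2 = 2 * B / k by rewrite sqr_sqrtr// divr_ge0 ?mulr_ge0// ltW.
have [eta eta0 osc] := uniform_modulus A cg e0.
exists (2 * B / eta ^+ 2); first by rewrite divr_ge0 ?sqr_ge0// mulr_ge0.
move=> x y.
have k'0 : 0 <= 2 * B / eta ^+ 2 * (y - x) ^+ 2.
  by rewrite mulr_ge0 ?sqr_ge0// divr_ge0 ?sqr_ge0// mulr_ge0.
have kx : 0 <= k * x ^+ 2 by rewrite mulr_ge0 ?sqr_ge0// ltW.
have b2 : `|g y - g x| <= 2 * B.
  by rewrite (le_trans (ler_normB _ _))//; have := gB x; have := gB y; lra.
have [xy|xy] := leP `|x - y| eta.
  have [xA|xA] := boolP (- A <= x <= A).
    by rewrite distrC; have := osc x y xA xy; lra.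
  have : A ^+ 2 <= x ^+ 2.
    rewrite -(real_normK (num_real x)) lerXn2r ?nnegrE ?sqrtr_ge0//.
    by rewrite -ler_norml -ltNge in xA; exact: ltW.
  rewrite A2 ler_pdivrMr// mulrC; lra.
have : 2 * B <= 2 * B / eta ^+ 2 * (y - x) ^+ 2.
  rewrite -mulrA ler_peMr ?mulr_ge0// mulrC ler_pdivlMr ?exprn_gt0// mul1r.
  rewrite -(real_normK (num_real (y - x))) distrC.
  by rewrite lerXn2r ?nnegrE ?normr_ge0 ?(ltW eta0) ?(ltW xy).
lra.
Qed.

Lemma invr_sqrtn_cvg0 (K e : R) : 0 <= K -> 0 < e ->
  \forall n \near \oo, K / Num.sqrt n%:R <= e.
Proof.
move=> K0 e0; near=> n.
have n0 : (0 : R) < n%:R by near: n; exact: nbhs_infty_gtr.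
have h : (K / e) ^+ 2 <= n%:R by near: n; exact: nbhs_infty_ger.
rewrite ler_pdivrMr ?sqrtr_gt0// mulrC -ler_pdivrMr//.
by rewrite -(ger0_norm (divr_ge0 K0 (ltW e0))) -sqrtr_sqr ler_wsqrtr.
Unshelve. all: by end_near. Qed.

Lemma invn_cvg0 (K e : R) : 0 < e -> \forall n \near \oo, K / n%:R <= e.
Proof.
move=> e0; near=> n.
have n0 : (0 : R) < n%:R by near: n; exact: nbhs_infty_gtr.
rewrite ler_pdivrMr// mulrC -ler_pdivrMr//.
by near: n; exact: nbhs_infty_ger.
Unshelve. all: by end_near. Qed.

Variable p : T -> R.
Hypotheses (p0 : forall c, 0 <= p c) (p1 : \sum_c p c = 1).

Lemma iidE_sqr_normalized (xi : T -> R) n : (0 < n)%N -> \sum_c p c * xi c = 0 ->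
  iidE p (fun s : {ffun 'I_n -> T} => ((Num.sqrt n%:R)^-1 * \sum_k xi (s k)) ^+ 2)
  = \sum_c p c * xi c ^+ 2.
Proof.
move=> n0 xi0; have n0' : n%:R != 0 :> R by rewrite pnatr_eq0 -lt0n.
under eq_fun do rewrite exprMn.
by rewrite iidEZ iidE_sqr_sum// exprVn sqr_sqrtr// mulrA mulVf// mul1r.
Qed.

Theorem central_limit (xi : T -> R) g : \sum_c p c * xi c = 0 ->
  continuous g -> (exists B : R, forall x, `|g x| <= B) ->
  iidE p (fun s : {ffun 'I_n -> T} => g ((Num.sqrt n%:R)^-1 * \sum_k xi (s k)))
    @[n --> \oo] --> normal_expect (\sum_c p c * xi c ^+ 2) g.
Proof.
move=> xi0 cg [B gB].
have v0 : 0 <= \sum_c p c * xi c ^+ 2.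
  by rewrite sumr_ge0// => c _; rewrite mulr_ge0 ?sqr_ge0.
have sq n := @iidE_sqr_normalized xi n.
set v := \sum_c p c * xi c ^+ 2 in v0 sq *.
have mg := continuous_measurable_fun cg.
apply/cvgrPdist_le => e e0.
have [vp|vn] := boolP (0 < v); last first.
  have v00 : v = 0 by apply/eqP; rewrite eq_le v0 andbT leNgt.
  rewrite /normal_expect (negbTE vn).
  (* With zero variance the normalized sum has zero second moment, so at base point 0 only [e]
     survives in expectation. *)
  have [k k0 hk] := modulus_quadratic cg gB e0 ltr01.
  near=> n; have n0 : (0 < n)%N by near: n; exact: nbhs_infty_gt.
  rewrite distrC -[X in _ - X](iidE_cst p1 n (g 0)) -mulN1r -iidEZ -iidED.
  have ek : iidE p ((fun _ : {ffun 'I_n -> T} => e) \+ (fun s =>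
      k * ((Num.sqrt n%:R)^-1 * \sum_k xi (s k)) ^+ 2)) = e.
    by rewrite iidED iidE_cst// iidEZ sq// v00 mulr0 addr0.
  rewrite -[leRHS]ek.
  apply: iidE_norm_le => // s /=; rewrite mulN1r.
  by apply: le_trans (hk 0 _) _; rewrite expr0n/= mulr0 addr0 subr0.
pose sg := Num.sqrt v.
have sg0 : 0 < sg by rewrite sqrtr_gt0.
have sgv : \sum_c p c * xi c ^+ 2 = sg ^+ 2 by rewrite sqr_sqrtr.
(* Five shares are spent: one on the smooth comparison, and two on each replacement of [g] by [h],
   under the walk and under the Gaussian law. *)
have e4 : 0 < e / 8 by rewrite divr_gt0.
have k0 : 0 < e / 8 / (v + 1) by rewrite divr_gt0// ltr_wpDl.
have [h [M [M0 hM mh hB hg]]] := smooth_approx cg gB e4 k0.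
have kv : e / 8 / (v + 1) * v <= e / 8.
  rewrite -mulrA ler_piMr//; first exact: ltW.
  by rewrite mulrC ler_pdivrMr ?mul1r ?lerDl// ltr_wpDl.
rewrite (normal_expect_gauss vp mg gB) -/sg.
pose K := \sum_c p c * `|xi c| ^+ 3 + sg ^+ 3 * 264 * Num.sqrt 2.
have K0 : 0 <= K.
  apply: addr_ge0; first by apply: sumr_ge0 => c _; exact: mulr_ge0.
  apply: mulr_ge0; last exact: sqrtr_ge0.
  by apply: mulr_ge0; [apply: exprn_ge0; exact: ltW|exact: ler0n].
near=> n; have n0 : (0 < n)%N by near: n; exact: nbhs_infty_gt.
have small : M * K / Num.sqrt n%:R <= e / 8.
  by near: n; apply: invr_sqrtn_cvg0 => //; exact: mulr_ge0.
pose L (s : {ffun 'I_n -> T}) := (Num.sqrt n%:R)^-1 * \sum_k xi (s k).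
have e1 : `|iidE p (fun s => h (L s)) - gauss 0 sg h| <= e / 8.
  exact: le_trans (clt_smooth p0 p1 xi0 sg0 sgv M0 hM mh hB n0) small.
have e2 : `|gauss 0 sg (h \+ (fun x => -1 * g x)) - (0 + 0 * sg ^+ 2)|
    <= e / 8 + (e / 8 / (v + 1)) * sg ^+ 2 + 0 * (sg ^+ 3 * 264 * Num.sqrt 2).
  apply: (@gauss_expansion _ _ _ _ _ 0) => //.
    apply: gauss_integrableD; first exact: gauss_integrable_bounded hB.
    by apply: gauss_integrableZ; exact: gauss_integrable_bounded gB.
  by move=> y; rewrite !mul0r !addr0 !subr0 /= mulN1r; exact: hg.
rewrite !mul0r !addr0 subr0 sqr_sqrtr// in e2.
have ig := gauss_integrable_bounded 0 sg mg gB.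
have ih := gauss_integrable_bounded 0 sg mh hB.
rewrite gaussD ?gaussZ ?mulN1r// in e2; last exact: gauss_integrableZ.
have eE : iidE p ((fun=> e / 8) \+ (fun s => e / 8 / (v + 1) * L s ^+ 2))
    = e / 8 + e / 8 / (v + 1) * v.
  by rewrite iidED iidE_cst// iidEZ sq.
have e3 : `|iidE p (fun s => h (L s)) - iidE p (fun s => g (L s))|
    <= e / 8 + e / 8 / (v + 1) * v.
  rewrite -mulN1r -iidEZ -iidED -eE.
  by apply: iidE_norm_le => // s /=; rewrite mulN1r.
rewrite -[X in `|_ - X|]/(iidE p (fun s => g (L s))).
move: e1 e2 e3; rewrite !ler_norml => /andP[? ?] /andP[? ?] /andP[? ?].
by apply/andP; split; lra.
Unshelve. all: by end_near. Qed.

Definition frequency n (s : {ffun 'I_n -> T}) (c : T) : R :=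
  #|[set k | s k == c]|%:R / n%:R.

Lemma sum_frequency n (s : {ffun 'I_n -> T}) (a : T -> R) :
  \sum_c a c * frequency s c = (\sum_k a (s k)) / n%:R.
Proof.
rewrite big_distrl/= (partition_big s xpredT)//=; apply: eq_bigr => c _.
rewrite (eq_bigr (fun=> a c / n%:R)); last by move=> k /eqP ->.
rewrite sumr_const /frequency mulrA mulrAC mulr_natr; congr (_ *+ _).
(* The set in [frequency] is a classical one, so its membership test goes through [asbool]. *)
by apply: eq_card => k; rewrite unfold_in /=; exact: asboolb.
Qed.

(** Linear statistics of the frequencies are exactly normalized centered sums, to which the central
    limit theorem and the variance formula apply. *)
Lemma sqrtn_frequency n (s : {ffun 'I_n -> T}) (a : T -> R) : (0 < n)%N ->
  Num.sqrt n%:R * \sum_c a c * (frequency s c - p c)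
  = (Num.sqrt n%:R)^-1 * \sum_k (a (s k) - \sum_c p c * a c).
Proof.
move=> n0; under eq_bigr do rewrite mulrBr.
rewrite sumrB sum_frequency; set m := \sum_c p c * a c.
rewrite (_ : \sum_c a c * p c = m); last by apply: eq_bigr => c _; rewrite mulrC.
rewrite (_ : \sum_k (a (s k) - m) = \sum_k a (s k) - n%:R * m); last first.
  by rewrite sumrB sumr_const card_ord mulr_natl.
have sn : Num.sqrt n%:R != 0 :> R by rewrite gt_eqF// sqrtr_gt0 ltr0n.
have n2 : n%:R = Num.sqrt n%:R ^+ 2 :> R by rewrite sqr_sqrtr.
set t := Num.sqrt n%:R in sn n2 *.
by rewrite n2; field.
Qed.

Lemma sum_centered (a : T -> R) : \sum_c p c * (a c - \sum_c p c * a c) = 0.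
Proof.
under eq_bigr do rewrite mulrBr.
by rewrite sumrB -big_distrl/= p1 mul1r subrr.
Qed.

Lemma sum_centered_sqr (a : T -> R) :
  \sum_c p c * (a c - \sum_c p c * a c) ^+ 2
  = \sum_c p c * a c ^+ 2 - (\sum_c p c * a c) ^+ 2.
Proof.
set m := \sum_c p c * a c.
transitivity (\sum_c (p c * a c ^+ 2 + (- 2 * m * (p c * a c) + m ^+ 2 * p c))).
  by apply: eq_bigr => c _; ring.
by rewrite !big_split/= -!big_distrr/= p1 -/m; ring.
Qed.

(** Each coordinate is a normalized sum of centered indicators, of variance at most 1. One factor
    [#|T|] comes from Cauchy-Schwarz, the other from summing over coordinates. *)
Lemma iidE_sqr_deviation n : (0 < n)%N ->
  iidE p (fun s : {ffun 'I_n -> T} =>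
    (Num.sqrt n%:R * \sum_c `|frequency s c - p c|) ^+ 2) <= #|T|%:R ^+ 2.
Proof.
move=> n0; pose U c0 (s : {ffun 'I_n -> T}) :=
  Num.sqrt n%:R * (frequency s c0 - p c0).
have EU c0 : iidE p (fun s => U c0 s ^+ 2) <= 1.
  pose d c : R := (c == c0)%:R.
  have dS (q : T -> R) : \sum_c d c * q c = q c0.
    rewrite (bigD1 c0)//= /d eqxx mul1r big1 ?addr0// => c /negbTE ->.
    by rewrite mul0r.
  have UE s : U c0 s = (Num.sqrt n%:R)^-1 * \sum_k (d (s k) - \sum_c p c * d c).
    by rewrite -sqrtn_frequency// dS.
  under eq_fun do rewrite UE.
  rewrite (iidE_sqr_normalized (xi := fun c => d c - \sum_c p c * d c)) ?sum_centered//.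
  rewrite sum_centered_sqr (_ : \sum_c p c * d c ^+ 2 = p c0); last first.
    rewrite -[RHS]dS; apply: eq_bigr => c _.
    by rewrite mulrC; congr (_ * _); rewrite /d; case: eqP => _; rewrite ?expr1n ?expr0n.
  rewrite lerBlDr (le_trans (y := 1)) ?lerDl ?sqr_ge0//.
  by rewrite -p1 (bigD1 c0)//= lerDl sumr_ge0.
have CS s : (Num.sqrt n%:R * \sum_c `|frequency s c - p c|) ^+ 2
    <= #|T|%:R * \sum_c U c s ^+ 2.
  rewrite big_distrr/= (eq_bigr (fun c => `|U c s|)); last first.
    by move=> c _; rewrite normrM ger0_norm ?sqrtr_ge0.
  set W := \sum_c `|U c s|.
  (* Cauchy-Schwarz by Lagrange's identity: this double sum is twice the difference of the two
     sides. *)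
  have : 0 <= \sum_c \sum_d (`|U c s| - `|U d s|) ^+ 2.
    by apply: sumr_ge0 => c _; apply: sumr_ge0 => d _; exact: sqr_ge0.
  rewrite (eq_bigr (fun c => #|T|%:R * U c s ^+ 2
     + (- 2 * W * `|U c s| + \sum_d U d s ^+ 2))); last first.
    move=> c _.
    rewrite (eq_bigr (fun d => U c s ^+ 2 + (- 2 * `|U c s| * `|U d s| + U d s ^+ 2))).
      rewrite !big_split/= sumr_const -(mulr_natl (U c s ^+ 2)) -big_distrr/= -/W; ring.
    move=> d _; rewrite -(real_normK (num_real (U c s))).
    by rewrite -(real_normK (num_real (U d s))); ring.
  rewrite !big_split/= -!big_distrr/= sumr_const -(mulr_natl (\sum_c U c s ^+ 2)) -/W.
  by set Q := \sum_c U c s ^+ 2; lra.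
apply: le_trans (iidE_le p0 CS) _.
rewrite iidEZ iidE_bigsum expr2 ler_wpM2l//.
apply: le_trans (ler_sum _ (fun c _ => EU c)) _.
by rewrite sumr_const.
Qed.

Theorem delta_method (F : (T -> R) -> R) (a : T -> R) g : is_gradient p F a ->
  continuous g -> (exists B : R, forall x, `|g x| <= B) ->
  iidE p (fun s : {ffun 'I_n -> T} =>
      g (Num.sqrt n%:R * (F (frequency s) - F p)))
    @[n --> \oo] -->
  normal_expect (\sum_c p c * a c ^+ 2 - (\sum_c p c * a c) ^+ 2) g.
Proof.
move=> gF cg [B gB].
have B0 : 0 <= B by apply: le_trans (gB 0).
pose xi c := a c - \sum_c p c * a c.
have xi0 : \sum_c p c * xi c = 0 by exact: sum_centered.
rewrite -sum_centered_sqr; have := central_limit xi0 cg (ex_intro _ B gB).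
set v := \sum_c p c * xi c ^+ 2 => clt.
have v0 : 0 <= v by rewrite sumr_ge0// => c _; rewrite mulr_ge0 ?sqr_ge0.
apply/cvgrPdist_le => e e0; have e10 : 0 < e / 10 by rewrite divr_gt0.
have divM (x : R) : 0 <= x -> e / 10 / (x + 1) * x <= e / 10.
  move=> x0; rewrite -mulrA ler_piMr//; first by rewrite ltW.
  by rewrite mulrC ler_pdivrMr ?mul1r ?lerDl// ltr_wpDl.
have k0 : 0 < e / 10 / (v + 1) by rewrite divr_gt0// ltr_wpDl.
have [k' k'0 hk] := modulus_quadratic cg gB e10 k0.
pose N2 : R := #|T|%:R ^+ 2.
have N20 : 0 <= N2 by exact: sqr_ge0.
(* Order of choices: [k'] from the modulus of [g], then the relative remainder [r] with
   [k' * r ^+ 2 * N2] at most [e / 10], then the radius [d], then [n]. *)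
pose r := Num.sqrt (e / 10 / (k' * N2 + 1)).
have kN0 : 0 <= k' * N2 by rewrite mulr_ge0.
have r20 : 0 < e / 10 / (k' * N2 + 1) by rewrite divr_gt0// ltr_wpDl.
have r0 : 0 < r by rewrite sqrtr_gt0.
have r2 : r ^+ 2 = e / 10 / (k' * N2 + 1) by rewrite sqr_sqrtr// ltW.
have [d d0 hF] := gF r r0.
near=> n; have n0 : (0 < n)%N by near: n; exact: nbhs_infty_gt.
have close : `|normal_expect v g - iidE p (fun s : {ffun 'I_n -> T} =>
    g ((Num.sqrt n%:R)^-1 * \sum_k xi (s k)))| <= e / 10.
  by near: n; move/cvgrPdist_le: clt; apply.
have small : 2 * B / d ^+ 2 * N2 / n%:R <= e / 10.
  by near: n; exact: invn_cvg0.
have nR0 : 0 < n%:R :> R by rewrite ltr0n.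
have sn0 : 0 < Num.sqrt n%:R :> R by rewrite sqrtr_gt0.
pose L (s : {ffun 'I_n -> T}) := (Num.sqrt n%:R)^-1 * \sum_k xi (s k).
pose Z (s : {ffun 'I_n -> T}) := Num.sqrt n%:R * (F (frequency s) - F p).
pose W (s : {ffun 'I_n -> T}) := Num.sqrt n%:R * \sum_c `|frequency s c - p c|.
pose k := e / 10 / (v + 1).
(* The first term covers frequencies within [d] of [p], where the remainder is at most [r * W s].
   The second is a Markov bound for the others: there [W s] is at least [d] times the square root of
   [n]. *)
pose w := k' * r ^+ 2 + 2 * B / d ^+ 2 / n%:R.
have Bd0 : 0 <= 2 * B / d ^+ 2 / n%:R.
  by rewrite !divr_ge0 ?sqr_ge0 ?(ltW nR0)// mulr_ge0.
have w0 : 0 <= w by apply: addr_ge0 => //; rewrite mulr_ge0 ?sqr_ge0.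
have pt s : `|g (Z s) - g (L s)| <= e / 10 + (k * L s ^+ 2 + w * W s ^+ 2).
  have kL : 0 <= k * L s ^+ 2 by rewrite mulr_ge0 ?sqr_ge0// ltW.
  have kW : 0 <= k' * r ^+ 2 * W s ^+ 2.
    by rewrite mulr_ge0 ?sqr_ge0// mulr_ge0 ?sqr_ge0.
  have dW : 0 <= 2 * B / d ^+ 2 / n%:R * W s ^+ 2 by rewrite mulr_ge0 ?sqr_ge0.
  rewrite /w mulrDl; have [hd|/existsNP[c hc]] :=
      pselect (forall c, `|frequency s c - p c| <= d).
    have Z_L : (Z s - L s) ^+ 2 <= r ^+ 2 * W s ^+ 2.
      rewrite -exprMn -(real_normK (num_real (Z s - L s))).
      rewrite lerXn2r ?nnegrE ?mulr_ge0 ?sumr_ge0 ?(ltW r0) ?(ltW sn0)//.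
      rewrite /L -sqrtn_frequency// -mulrBr normrM (gtr0_norm sn0) /W mulrCA.
      by rewrite ler_wpM2l ?(ltW sn0)// hF.
    have := hk (L s) (Z s); have := ler_wpM2l k'0 Z_L.
    rewrite mulrA -/k; lra.
  have : 2 * B <= 2 * B / d ^+ 2 / n%:R * W s ^+ 2.
    rewrite -!mulrA ler_wpM2l// ler_peMr//.
    rewrite mulrA -invfM mulrC ler_pdivlMr ?mulr_gt0 ?exprn_gt0// mul1r.
    rewrite -[X in _ * X <= _]sqr_sqrtr ?(ltW nR0)// -exprMn.
    rewrite lerXn2r ?nnegrE ?mulr_ge0 ?sumr_ge0 ?(ltW d0) ?(ltW sn0)//.
    rewrite mulrC ler_wpM2l ?(ltW sn0)//.
    move/negP: hc; rewrite -ltNge => /ltW /le_trans; apply.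
    by rewrite (bigD1 c)//= lerDl sumr_ge0.
  have : `|g (Z s) - g (L s)| <= 2 * B.
    by rewrite (le_trans (ler_normB _ _))//; have := gB (Z s); have := gB (L s); lra.
  lra.
have EL : iidE p (fun s => L s ^+ 2) = v by exact: iidE_sqr_normalized.
have EW : iidE p (fun s => W s ^+ 2) <= N2 by exact: iidE_sqr_deviation.
have diff : `|iidE p (fun s => g (Z s)) - iidE p (fun s => g (L s))|
    <= e / 10 + (k * v + w * N2).
  rewrite -mulN1r -iidEZ -iidED.
  have eE : iidE p ((fun=> e / 10) \+ ((fun s => k * L s ^+ 2) \+ (fun s => w * W s ^+ 2)))
      <= e / 10 + (k * v + w * N2).
    by rewrite !iidED iidE_cst// !iidEZ EL !lerD2l ler_wpM2l.
  by apply: le_trans eE; apply: iidE_norm_le => // s /=; rewrite mulN1r.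
have kv : k * v <= e / 10 by exact: divM.
have wN : w * N2 <= e / 10 + e / 10.
  rewrite /w mulrDl lerD//.
    by rewrite r2 mulrAC mulrC divM.
  by rewrite mulrAC.
move: diff close; rewrite !ler_norml => /andP[? ?] /andP[? ?].
by apply/andP; split; lra.
Unshelve. all: by end_near. Qed.

End CentralLimit.

Theorem theorem3 (R : realType) (nR nC : nat) (p : 'I_nR -> 'I_nC -> R)
    (f : R -> R) :
  (forall i j, 0 <= p i j) ->
  \sum_(i < nR) \sum_(j < nC) p i j = 1 ->
  (* f convex, 0 * f(0/0) = 0, f(0+) = 0, f(1) = 0 *)
  convex_function (`[0, +oo[%classic : set R^o) f ->
  0 * f (0 / 0) = 0 ->
  f x @[x --> 0^'+] --> 0 ->
  f 1 = 0 ->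
  (* f differentiable (on its domain x > 0, and at every point where f' is used) *)
  (forall x : R, 0 < x -> derivable f x 1) ->
  (forall j, derivable f (colm p j) 1) ->
  (forall i j, derivable f (p i j / rowm p i) 1) ->
  (* standing nondegeneracy assumptions *)
  (forall j, 0 < colm p j) ->
  (forall i, 0 < rowm p i) ->
  (forall i, 0 < - \sum_(t < nC) f (p i t / rowm p i)) ->
  \sum_(t < nC) f (colm p t) != 0 ->
  cvg_in_law_normal
    (fun n g => multinom_expect p n
       (fun N => g (Num.sqrt n%:R * (PhiGf f (phat n N) - PhiGf f p))))
    (sigma2Gf f p).
Proof.
move=> p0 p1 _ _ _ _ _ fcol frow _ rowp Gp Sp g cg gB.
pose P (c : 'I_nR * 'I_nC) := p c.1 c.2.
have P0 c : 0 <= P c by exact: p0.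
have P1 : \sum_c P c = 1 by rewrite -p1 pair_big.
(* [multinom_expect] and [phat] match [iidE] and [frequency] by conversion; only the variance
   remains, where squaring removes the sign of the gradient and [deltaf] factors out. *)
have := delta_method P0 P1 (is_gradient_PhiGf fcol frow rowp Gp Sp) cg gB.
rewrite (_ : _ - _ = sigma2Gf f p)//.
rewrite /sigma2Gf !pair_big/= mulrBr -exprMn !big_distrr/=.
congr (_ - _).
  by apply: eq_bigr => c _; rewrite sqrrN exprMn mulrCA.
rewrite -sqrrN -sumrN; congr (_ ^+ 2).
by apply: eq_bigr => c _; rewrite mulrN opprK mulrCA.
Qed.
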